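(* Let $f,g:\mathbb{R}^{d_x}\times\mathbb{R}^{d_y}\to\mathbb{R}$ be such that: $g(x,y)$ is $\mu$-strongly convex in $y$, has $L_g$-Lipschitz gradient, $\rho_g$-Lipschitz Hessian and $\nu_g$-Lipschitz third-order derivative; $f(x,y)$ is $C_f$-Lipschitz in $y$, has $L_f$-Lipschitz gradient and $\rho_f$-Lipschitz Hessian, and is three times continuously differentiable; and $\varphi(x)=f(x,y^*(x))$ is bounded below. Let $\ell=\max\{C_f,L_f,L_g,\rho_g,\rho_f,\nu_g\}$ and $\kappa=\ell/\mu$. Then for $\lambda\ge2L_f/\mu$, the Hessian $\nabla^2\mathcal{L}^*_\lambda(x)$ is $D_5$-Lipschitz, where $$D_5:=\Big(1+\frac{4L_g}{\mu}\Big)^2\Big(3\rho_f+\frac{2L_f\rho_g}{\mu}\Big)+\Big(1+\frac{L_g}{\mu}\Big)^2\frac{C_f\nu_g}{\mu}+\Big(2+\frac{5L_g}{\mu}\Big)D_2\rho_g+\Big(1+\frac{L_g}{\mu}\Big)^2\frac{C_f\rho_g^2}{\mu^2}+L_gD_4=\mathcal{O}(\ell\kappa^5),$$ with $$D_2:=\Big(\frac1\mu+\frac{2L_g}{\mu^2}\Big)\Big(L_f+\frac{C_f\rho_g}{\mu}\Big),$$ $$D_4:=\frac{2\rho_g}{\mu^2}\Big(1+\frac{L_g}{\mu}\Big)^2\Big(L_f+\frac{C_f\rho_g}{\mu}\Big)+\frac{14L_g\rho_gD_2}{\mu^2}+\frac{50L_g^2}{\mu^3}\Big(\frac{C_f\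nu_g}{\mu}+\rho_f\Big).$$
   Context: Lipschitz continuity of derivatives is with respect to the joint variable $(x,y)$, in operator norm. Here $y^*(x)=\arg\min_{y}g(x,y)$, $g^*(x)=g(x,y^*(x))$, $\mathcal{L}_\lambda(x,y)=f(x,y)+\lambda(g(x,y)-g^*(x))$, $y^*_\lambda(x)=\arg\min_y\mathcal{L}_\lambda(x,y)$ and $\mathcal{L}^*_\lambda(x)=\mathcal{L}_\lambda(x,y^*_\lambda(x))$; for $\lambda\ge2L_f/\mu$, $\mathcal{L}_\lambda(x,\cdot)$ is strongly convex so $y^*_\lambda$ is well defined. $\mathcal{O}(\cdot)$ hides an absolute constant. *)

(* Defs.v *)
From HB Require Import structures.
From mathcomp Require Import all_boot all_order all_algebra.
From mathcomp Require Import all_classical all_reals all_analysis.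

Set Implicit Arguments.
Unset Strict Implicit.
Unset Printing Implicit Defensive.

Import Order.TTheory GRing.Theory Num.Theory.
Import numFieldNormedType.Exports.

Local Open Scope classical_set_scope.
Local Open Scope ring_scope.

(* The library norm on 'rV[R]_n is the sup norm.  It only serves as the carrier
   of the topology (differentiability, continuity); every Lipschitz constant
   below refers to the Euclidean norm and the operator norms it induces. *)
Definition enorm (R : realType) (n : nat) (v : 'rV[R]_n) : R :=
  Num.sqrt (\sum_(i < n) v 0 i ^+ 2).

(* Matrices act on row vectors from the right, as in the library's jacobian. *)
Definition opnorm (R : realType) (m n : nat) (A : 'M[R]_(m, n)) : R :=
  sup [set enorm (v *m A) | v in [set v : 'rV[R]_m | enorm v <= 1]].

(* Operator norm of the trilinear form (u, v, w) |-> v *m T u *m w^T. *)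
Definition opnorm3 (R : realType) (n : nat) (T : 'rV[R]_n -> 'M[R]_n) : R :=
  sup [set opnorm (T u) | u in [set u : 'rV[R]_n | enorm u <= 1]].

Definition grad (R : realType) (n : nat) (f : 'rV[R]_n -> R) (z : 'rV[R]_n) :
    'rV[R]_n :=
  \row_(i < n) 'D_(delta_mx 0 i) f z.

Definition hess (R : realType) (n : nat) (f : 'rV[R]_n -> R) (z : 'rV[R]_n) :
    'M[R]_n :=
  'J (grad f) z.

Definition third (R : realType) (n : nat) (f : 'rV[R]_n -> R) (z : 'rV[R]_n) :
    'rV[R]_n -> 'M[R]_n :=
  fun u => 'd (hess f) z u.

Definition differentiable1 (R : realType) (n : nat) (f : 'rV[R]_n -> R) :=
  forall z, differentiable f z.

Definition differentiable2 (R : realType) (n : nat) (f : 'rV[R]_n -> R) :=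
  differentiable1 f /\ forall z, differentiable (grad f) z.

Definition differentiable3 (R : realType) (n : nat) (f : 'rV[R]_n -> R) :=
  differentiable2 f /\ forall z, differentiable (hess f) z.

(* In finite dimension, continuity of z |-> third f z for the operator norm is
   continuity in each direction u. *)
Definition C3 (R : realType) (n : nat) (f : 'rV[R]_n -> R) :=
  differentiable3 f /\ forall u, continuous (fun z => third f z u).

Definition lipschitz_grad (R : realType) (n : nat) (L : R)
    (f : 'rV[R]_n -> R) :=
  differentiable1 f /\
  forall z z', enorm (grad f z - grad f z') <= L * enorm (z - z').

Definition lipschitz_hess (R : realType) (n : nat) (L : R)
    (f : 'rV[R]_n -> R) :=
  differentiable2 f /\
  forall z z', opnorm (hess f z - hess f z') <= L * enorm (z - z').

Definition lipschitz_third (R : realType) (n : nat) (L : R)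
    (f : 'rV[R]_n -> R) :=
  differentiable3 f /\
  forall z z',
    opnorm3 (fun u => third f z u - third f z' u) <= L * enorm (z - z').

(* R^dx * R^dy is 'rV_(dx + dy), with (x, y) := row_mx x y. *)
Definition lipschitz_in_y (R : realType) (dx dy : nat) (L : R)
    (f : 'rV[R]_(dx + dy) -> R) :=
  forall (x : 'rV[R]_dx) (y y' : 'rV[R]_dy),
    `|f (row_mx x y) - f (row_mx x y')| <= L * enorm (y - y').

Definition strongly_convex (R : realType) (n : nat) (mu : R)
    (h : 'rV[R]_n -> R) :=
  forall (y y' : 'rV[R]_n) (t : R), 0 <= t <= 1 ->
    h (t *: y + (1 - t) *: y') <=
      t * h y + (1 - t) * h y' - mu / 2 * t * (1 - t) * enorm (y - y') ^+ 2.

(* A chosen global minimizer; an unspecified default point if there is none. *)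
Definition argmin (R : realType) (n : nat) (h : 'rV[R]_n -> R) : 'rV[R]_n :=
  get [set y | forall y', h y <= h y'].

Section Bilevel.
Context (R : realType) (dx dy : nat).
Implicit Types (f g : 'rV[R]_(dx + dy) -> R) (lam : R).

Definition ystar g (x : 'rV[R]_dx) : 'rV[R]_dy :=
  argmin (fun y => g (row_mx x y)).

Definition gstar g (x : 'rV[R]_dx) : R := g (row_mx x (ystar g x)).

Definition hyperobj f g (x : 'rV[R]_dx) : R := f (row_mx x (ystar g x)).

Definition penalty f g lam (x : 'rV[R]_dx) (y : 'rV[R]_dy) : R :=
  f (row_mx x y) + lam * (g (row_mx x y) - gstar g x).

Definition ystar_pen f g lam (x : 'rV[R]_dx) : 'rV[R]_dy :=
  argmin (penalty f g lam x).

Definition penalty_star f g lam (x : 'rV[R]_dx) : R :=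
  penalty f g lam x (ystar_pen f g lam x).

End Bilevel.

Definition D2 (R : realType) (mu Cf Lf Lg rhog : R) : R :=
  (1 / mu + 2 * Lg / mu ^+ 2) * (Lf + Cf * rhog / mu).

Definition D4 (R : realType) (mu Cf Lf Lg rhof rhog nug : R) : R :=
  2 * rhog / mu ^+ 2 * (1 + Lg / mu) ^+ 2 * (Lf + Cf * rhog / mu)
  + 14 * Lg * rhog * D2 mu Cf Lf Lg rhog / mu ^+ 2
  + 50 * Lg ^+ 2 / mu ^+ 3 * (Cf * nug / mu + rhof).

Definition D5 (R : realType) (mu Cf Lf Lg rhof rhog nug : R) : R :=
  (1 + 4 * Lg / mu) ^+ 2 * (3 * rhof + 2 * Lf * rhog / mu)
  + (1 + Lg / mu) ^+ 2 * (Cf * nug / mu)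
  + (2 + 5 * Lg / mu) * D2 mu Cf Lf Lg rhog * rhog
  + (1 + Lg / mu) ^+ 2 * (Cf * rhog ^+ 2 / mu ^+ 2)
  + Lg * D4 mu Cf Lf Lg rhof rhog nug.

Definition ell (R : realType) (Cf Lf Lg rhof rhog nug : R) : R :=
  Num.max Cf (Num.max Lf (Num.max Lg (Num.max rhog (Num.max rhof nug)))).

Definition kappa (R : realType) (mu Cf Lf Lg rhof rhog nug : R) : R :=
  ell Cf Lf Lg rhof rhog nug / mu.

(* Main.v *)
(* Write h = f + lam g, z0 = (x, y0) and zl = (x, yl) for the minimizers y0 of
   g(x, .) and yl of h(x, .).  Then L*(x) = h(zl) - lam g(z0) is a difference of two
   minimal values.  The Hessian of x |-> min_y h(x, y) is the quadratic form of hess h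
   on the tangent vectors V = (v, D yl v) of the graph of yl, and these are
   hess h-orthogonal to the vertical vectors.  Orthogonality makes the increment of
   that Hessian between x and x' exactly (hess h(zl) - hess h(zl'))[V, W'], so neither
   the third derivative of f nor a second derivative of yl is needed.
   The factor lam multiplies only a difference of such increments for g, at zl and at
   z0.  It is compensated by |zl - z0| <= Cf / (lam mu) and |D yl - D y0| <= D2 / lam
   together with a second difference estimate for hess g.  With k = Lg / mu >= 1 the
   tangent vectors satisfy |V| <= (2 k + 3/2) |v| for yl and |V| <= (k + 1/2) |v| for
   y0, which leaves enough room below D5. *)
Require Import Defs.
From HB Require Import structures.
From mathcomp Require Import all_boot all_order all_algebra.
From mathcomp Require Import all_classical all_reals all_analysis.
From mathcomp Require Import ring lra.

Import Order.TTheory GRing.Theory Num.Theory.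
Import numFieldNormedType.Exports.

Local Open Scope classical_set_scope.
Local Open Scope ring_scope.

Set Implicit Arguments.
Unset Strict Implicit.
Unset Printing Implicit Defensive.

(** * Euclidean and operator norms *)

Definition dot (R : realType) (n : nat) (u v : 'rV[R]_n) : R := (u *m v^T) 0 0.

Section Dot.
Context (R : realType) (n : nat).
Implicit Types (u v w : 'rV[R]_n).

Lemma dotE u v : dot u v = \sum_(i < n) u 0 i * v 0 i.
Proof. by rewrite /dot mxE; apply: eq_bigr => i _; rewrite mxE. Qed.

Lemma dotC u v : dot u v = dot v u.
Proof. by rewrite !dotE; apply: eq_bigr => i _; rewrite mulrC. Qed.

Lemma dotDl u v w : dot (u + v) w = dot u w + dot v w.
Proof. by rewrite /dot mulmxDl mxE. Qed.

Lemma dotDr u v w : dot w (u + v) = dot w u + dot w v.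
Proof. by rewrite dotC dotDl !(dotC w). Qed.

Lemma dotZl a u v : dot (a *: u) v = a * dot u v.
Proof. by rewrite /dot -scalemxAl mxE. Qed.

Lemma dotZr a u v : dot u (a *: v) = a * dot u v.
Proof. by rewrite dotC dotZl dotC. Qed.

Lemma dotNl u v : dot (- u) v = - dot u v.
Proof. by rewrite -scaleN1r dotZl mulN1r. Qed.

Lemma dotNr u v : dot u (- v) = - dot u v.
Proof. by rewrite dotC dotNl dotC. Qed.

Lemma dotBl u v w : dot (u - v) w = dot u w - dot v w.
Proof. by rewrite dotDl dotNl. Qed.

Lemma dotBr u v w : dot w (u - v) = dot w u - dot w v.
Proof. by rewrite dotDr dotNr. Qed.

Lemma dot0l u : dot 0 u = 0.
Proof. by rewrite /dot mul0mx mxE. Qed.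

Lemma dot0r u : dot u 0 = 0.
Proof. by rewrite dotC dot0l. Qed.

Lemma dot_delta u i : dot u (delta_mx 0 i) = u 0 i.
Proof.
rewrite dotE (bigD1 i) //= !mxE !eqxx mulr1 big1 ?addr0 // => j ji.
by rewrite mxE (negbTE ji) andbF mulr0.
Qed.

Lemma enorm_ge0 u : 0 <= enorm u.
Proof. exact: sqrtr_ge0. Qed.

Lemma dot_ge0 u : 0 <= dot u u.
Proof. by rewrite dotE sumr_ge0 // => i _; rewrite -expr2 sqr_ge0. Qed.

Lemma enorm_sqr u : enorm u ^+ 2 = dot u u.
Proof.
rewrite sqr_sqrtr; last by rewrite sumr_ge0 // => i _; rewrite sqr_ge0.
by rewrite dotE; apply: eq_bigr => i _; rewrite expr2.
Qed.

Lemma enorm0 : enorm (0 : 'rV[R]_n) = 0.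
Proof. by apply/eqP; rewrite -[_ == _]sqrf_eq0 enorm_sqr dot0l. Qed.

Lemma enorm_eq0 u : enorm u = 0 -> u = 0.
Proof.
move=> u0; have : dot u u = 0 by rewrite -enorm_sqr u0 expr0n.
rewrite dotE => /eqP; rewrite psumr_eq0 => [/allP uu|i _]; last first.
  by rewrite -expr2 sqr_ge0.
apply/rowP => i; rewrite mxE; apply/eqP.
by have := uu i; rewrite mem_index_enum -expr2 sqrf_eq0 /=; apply.
Qed.

Lemma enorm_gt0 u : u != 0 -> 0 < enorm u.
Proof.
move=> u0; rewrite lt_neqAle enorm_ge0 andbT eq_sym.
by apply: contra u0 => /eqP/enorm_eq0 ->.
Qed.

Lemma enormZ a u : enorm (a *: u) = `|a| * enorm u.
Proof.
apply/eqP; rewrite -(eqrXn2 (n := 2)) ?mulr_ge0 ?enorm_ge0 //.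
by rewrite exprMn !enorm_sqr dotZl dotZr real_normK ?num_real // mulrA -expr2.
Qed.

Lemma enormN u : enorm (- u) = enorm u.
Proof. by rewrite -scaleN1r enormZ normrN1 mul1r. Qed.

Lemma enormB u v : enorm (u - v) = enorm (v - u).
Proof. by rewrite -opprB enormN. Qed.

Lemma dot_le u v : dot u v <= enorm u * enorm v.
Proof.
have [->|u0] := eqVneq u 0; first by rewrite dot0l mulr_ge0 ?enorm_ge0.
have [->|v0] := eqVneq v 0; first by rewrite dot0r mulr_ge0 ?enorm_ge0.
have ugt := enorm_gt0 u0; have vgt := enorm_gt0 v0.
have := dot_ge0 ((enorm v) *: u - (enorm u) *: v).
rewrite dotBl !dotBr !dotZl !dotZr -!enorm_sqr (dotC v u) => h.
have uv : 0 < enorm u * enorm v by rewrite mulr_gt0.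
rewrite -(ler_pM2l uv); nra.
Qed.

Lemma normr_dot_le u v : `|dot u v| <= enorm u * enorm v.
Proof.
rewrite ler_norml dot_le andbT lerNl -dotNl.
by apply: le_trans (dot_le _ _) _; rewrite enormN.
Qed.

Lemma enormD u v : enorm (u + v) <= enorm u + enorm v.
Proof.
rewrite -(ler_pXn2r (n := 2)) ?nnegrE ?addr_ge0 ?enorm_ge0 //.
rewrite enorm_sqr dotDl !dotDr -!enorm_sqr (dotC v u).
have := dot_le u v; nra.
Qed.

(** Take [w = u]. Bounds on vectors thus reduce to bounds on scalar pairings, to which the mean
    value theorem applies. *)
Lemma enorm_dual_le u C :
  0 <= C -> (forall w, dot u w <= C * enorm w) -> enorm u <= C.
Proof.
move=> C0 /(_ u); rewrite -enorm_sqr expr2.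
have [-> _|u0] := eqVneq u 0; first by rewrite enorm0.
by rewrite ler_pM2r // enorm_gt0.
Qed.

Lemma coord_le_enorm u i : `|u 0 i| <= enorm u.
Proof.
rewrite -(ler_pXn2r (n := 2)) ?nnegrE ?normr_ge0 ?enorm_ge0 //.
rewrite real_normK ?num_real // enorm_sqr dotE (bigD1 i) //= -expr2 lerDl.
by rewrite sumr_ge0 // => j _; rewrite -expr2 sqr_ge0.
Qed.

Lemma normr_le_enorm u : `|u| <= enorm u.
Proof.
rewrite [leLHS]/Num.Def.normr/= mx_normrE.
apply/bigmax_leP; split=> [|[i j] _]; first exact: enorm_ge0.
by rewrite ord1; apply: coord_le_enorm.
Qed.

Lemma coord_le_normr u i : `|u 0 i| <= `|u|.
Proof.
rewrite [leRHS]/Num.Def.normr/= mx_normrE.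
exact: (le_bigmax _ (fun ij : 'I_1 * 'I_n => `|u ij.1 ij.2|) (0, i)).
Qed.

Lemma enorm_le_sum u : enorm u <= \sum_(i < n) `|u 0 i|.
Proof.
rewrite -(ler_pXn2r (n := 2)) ?nnegrE ?enorm_ge0 ?sumr_ge0 //.
rewrite enorm_sqr dotE [leRHS]expr2 mulr_suml; apply: ler_sum => i _.
apply: le_trans (ler_norm _) _; rewrite normrM ler_wpM2l //.
by rewrite (bigD1 i) //= lerDl sumr_ge0.
Qed.

(** Together with [normr_le_enorm], this lets Euclidean remainder estimates be read in the sup-norm
    topology. The crude factor [n] never reaches a Lipschitz constant. *)
Lemma enorm_le_normr u : enorm u <= n%:R * `|u|.
Proof.
apply: le_trans (enorm_le_sum u) _.
apply: le_trans (ler_sum _ (fun i _ => coord_le_normr u i)) _.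
by rewrite sumr_const card_ord mulr_natl.
Qed.

End Dot.

Section BlockVectors.
Context (R : realType) (m n : nat).
Implicit Types (a c : 'rV[R]_m) (b d : 'rV[R]_n).

Lemma dot_row_mx a b c d : dot (row_mx a b) (row_mx c d) = dot a c + dot b d.
Proof. by rewrite /dot tr_row_mx mul_row_col mxE. Qed.

Lemma enorm_row_mx0 b : enorm (row_mx (0 : 'rV[R]_m) b) = enorm b.
Proof.
apply/eqP; rewrite -(eqrXn2 (n := 2)) ?enorm_ge0 //.
by rewrite !enorm_sqr dot_row_mx dot0l add0r.
Qed.

Lemma enorm_row_mx_0 a : enorm (row_mx a (0 : 'rV[R]_n)) = enorm a.
Proof.
apply/eqP; rewrite -(eqrXn2 (n := 2)) ?enorm_ge0 //.
by rewrite !enorm_sqr dot_row_mx dot0l addr0.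
Qed.

Lemma enorm_row_mx_le a b : enorm (row_mx a b) <= enorm a + enorm b.
Proof.
have -> : row_mx a b = row_mx a 0 + row_mx 0 b.
  by rewrite add_row_mx addr0 add0r.
by apply: le_trans (enormD _ _) _; rewrite enorm_row_mx0 enorm_row_mx_0.
Qed.

Lemma enorm_row_mx_sqr a b : enorm (row_mx a b) ^+ 2 = enorm a ^+ 2 + enorm b ^+ 2.
Proof. by rewrite !enorm_sqr dot_row_mx. Qed.

Lemma dot_lsubmx (w : 'rV[R]_(m + n)) a : dot (lsubmx w) a = dot w (row_mx a 0).
Proof. by rewrite -{2}[w]hsubmxK dot_row_mx dot0r addr0. Qed.

End BlockVectors.

(** Pythagoras instead of the triangle inequality: the factor can be as small as the root of
    [1 + c ^+ 2] instead of [1 + c]. *)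
Lemma enorm_row_mx_bound (R : realType) (m n : nat) (a : 'rV[R]_m) (b : 'rV[R]_n)
    (c S : R) : 0 <= c -> 0 <= S -> 1 + c ^+ 2 <= S ^+ 2 ->
  enorm b <= c * enorm a -> enorm (row_mx a b) <= S * enorm a.
Proof.
move=> c0 S0 cS bca.
rewrite -(ler_pXn2r (n := 2)) ?nnegrE ?enorm_ge0 ?mulr_ge0 ?enorm_ge0 //.
rewrite enorm_row_mx_sqr exprMn.
apply: (@le_trans _ _ ((1 + c ^+ 2) * enorm a ^+ 2)).
  rewrite mulrDl mul1r lerD2l -exprMn.
  by rewrite lerXn2r ?nnegrE ?mulr_ge0 ?enorm_ge0.
by rewrite ler_wpM2r ?sqr_ge0.
Qed.

Section Opnorm.
Context (R : realType) (m n : nat).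
Implicit Types (A : 'M[R]_(m, n)) (p : 'rV[R]_m) (q : 'rV[R]_n).

Let frob A : R := \sum_(i < m) enorm (row i A).

Lemma mulmx_bounded A : exists2 C, 0 <= C & forall p, enorm (p *m A) <= C * enorm p.
Proof.
exists (frob A) => [|p]; first by rewrite sumr_ge0 // => i _; rewrite enorm_ge0.
apply: enorm_dual_le => [|w].
  by rewrite mulr_ge0 ?enorm_ge0 ?sumr_ge0 // => i _; rewrite enorm_ge0.
rewrite mulmx_sum_row /dot mulmx_suml summxE /frob !mulr_suml.
apply: ler_sum => i _; rewrite -[_ 0 0]/(dot _ _) dotZl.
apply: le_trans (ler_norm _) _; rewrite normrM.
rewrite (mulrC (enorm (row i A))) -mulrA ler_pM //; first exact: coord_le_enorm.
exact: normr_dot_le.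
Qed.

(** [sup] is a genuine supremum only for a nonempty bounded set. *)
Lemma opnorm_has_sup A :
  has_sup [set enorm (v *m A) | v in [set v : 'rV[R]_m | enorm v <= 1]].
Proof.
split; first by exists (enorm (0 *m A)), 0 => //=; rewrite enorm0.
have [C C0 AC] := mulmx_bounded A.
exists C => _ [v /= v1 <-]; apply: le_trans (AC v) _.
by rewrite -[leRHS]mulr1 ler_wpM2l.
Qed.

Lemma opnorm_ge0 A : 0 <= opnorm A.
Proof.
apply: ub_le_sup; first exact: (opnorm_has_sup A).2.
by exists 0; rewrite /= ?mul0mx enorm0.
Qed.

Lemma enorm_mulmx_le A p : enorm (p *m A) <= opnorm A * enorm p.
Proof.
have [->|p0] := eqVneq p 0; first by rewrite mul0mx !enorm0 mulr0.
have pgt := enorm_gt0 p0.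
rewrite -ler_pdivrMr // mulrC -(ger0_norm (enorm_ge0 p)) -normfV -enormZ scalemxAl.
apply: ub_le_sup; first exact: (opnorm_has_sup A).2.
exists ((enorm p)^-1 *: p) => //=.
by rewrite enormZ ger0_norm ?invr_ge0 ?enorm_ge0 // mulVf // gt_eqF.
Qed.

Lemma dot_mulmx_le A p q : `|dot (p *m A) q| <= opnorm A * enorm p * enorm q.
Proof.
apply: le_trans (normr_dot_le _ _) _.
by rewrite ler_wpM2r ?enorm_ge0 // enorm_mulmx_le.
Qed.

Lemma opnorm_le A C : 0 <= C ->
  (forall p q, dot (p *m A) q <= C * enorm p * enorm q) -> opnorm A <= C.
Proof.
move=> C0 AC; apply: ge_sup; first exact: (opnorm_has_sup A).1.
move=> _ [v /= v1 <-]; apply: (@le_trans _ _ (C * enorm v)).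
  by apply: enorm_dual_le; rewrite ?mulr_ge0 ?enorm_ge0.
by rewrite -[leRHS]mulr1 ler_wpM2l.
Qed.

End Opnorm.

Lemma dot_mulmx_le3 (R : realType) (n : nat) (T : {linear 'rV[R]_n -> 'M[R]_n})
    (u p q : 'rV[R]_n) :
  `|dot (p *m T u) q| <= opnorm3 T * enorm u * enorm p * enorm q.
Proof.
have Tsup : has_ubound [set opnorm (T u) | u in [set u : 'rV[R]_n | enorm u <= 1]].
  (* By linearity the values on the basis vectors bound [T] on the unit ball, where all coordinates
     are at most 1 in absolute value. *)
  exists (\sum_(i < n) opnorm (T (delta_mx 0 i))) => _ [v /= v1 <-].
  apply: opnorm_le => [|p' q']; first by rewrite sumr_ge0 // => i _; rewrite opnorm_ge0.
  rewrite (row_sum_delta v) linear_sum mulmx_sumr /dot mulmx_suml summxE !mulr_suml.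
  apply: ler_sum => i _; rewrite -[_ 0 0]/(dot _ _) linearZ /= -scalemxAr dotZl.
  apply: le_trans (ler_norm _) _; rewrite normrM -[leRHS]mul1r ler_pM //.
    by apply: le_trans (coord_le_enorm v i) v1.
  exact: dot_mulmx_le.
have [->|u0] := eqVneq u 0.
  by rewrite linear0 mulmx0 dot0l normr0 enorm0 mulr0 !mul0r.
apply: le_trans (dot_mulmx_le _ _ _) _.
rewrite !ler_wpM2r ?enorm_ge0 //; have ugt := enorm_gt0 u0.
rewrite -ler_pdivrMr //.
apply: (@le_trans _ _ (opnorm (T ((enorm u)^-1 *: u)))); last first.
  apply: ub_le_sup => //; exists ((enorm u)^-1 *: u) => //=.
  by rewrite enormZ ger0_norm ?invr_ge0 ?enorm_ge0 // mulVf // gt_eqF.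
rewrite ler_pdivrMr //; apply: opnorm_le => [|p' q'].
  by rewrite mulr_ge0 ?opnorm_ge0 ?enorm_ge0.
have {1}-> : u = enorm u *: ((enorm u)^-1 *: u).
  by rewrite scalerA mulfV ?scale1r // gt_eqF.
rewrite linearZ /= -scalemxAr dotZl (mulrC (opnorm _)) -!mulrA ler_wpM2l ?enorm_ge0 //.
by apply: le_trans (ler_norm _) _; rewrite mulrA dot_mulmx_le.
Qed.

(** * Differentiation on row vectors *)

Lemma mx_linear_continuous (R : realType) (m n : nat) (W : normedModType R)
    (l : {linear 'M[R]_(m, n) -> W}) : continuous l.
Proof.
apply: bounded_linear_continuous; apply/linear_boundedP.
near=> r => M.
rewrite {1}(matrix_sum_delta M) linear_sum.
apply: (@le_trans _ _ ((\sum_i \sum_j `|l (delta_mx i j)|) * `|M|)); last first.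
  by rewrite ler_wpM2r.
apply: le_trans (ler_norm_sum _ _ _) _; rewrite mulr_suml; apply: ler_sum => i _.
rewrite linear_sum; apply: le_trans (ler_norm_sum _ _ _) _.
rewrite mulr_suml; apply: ler_sum => j _.
rewrite linearZ /= normrZ mulrC ler_wpM2l //.
rewrite [leRHS]/Num.Def.normr/= mx_normrE.
exact: (le_bigmax _ (fun ij : 'I_m * 'I_n => `|M ij.1 ij.2|) (i, j)).
Unshelve. all: by end_near. Qed.

(** A quadratic remainder is [o(k)], and the differential is unique. Derivatives of functions built
    from minimizers are identified this way, without an implicit function theorem. *)
Lemma differentiable_of_remainder (R : realType) (V W : normedModType R) (f : V -> W)
    (l : {linear V -> W}) (x : V) (C : R) :
  continuous l ->
  (forall k, `|f (x + k) - f x - l k| <= C * `|k| ^+ 2) ->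
  differentiable f x /\ 'd f x = l :> (V -> W).
Proof.
move=> cl fl.
have fx : f \o shift x = cst (f x) + l +o_ 0 id.
  apply/eqaddoP => _/posnumP[e].
  (* The summand 1 keeps the denominator positive when [C = 0]. *)
  have e0 : 0 < e%:num / (1 + `|C|) by rewrite divr_gt0 // ltr_wpDr.
  apply: filterS (nbhs0_le e0) => k ke.
  have -> : (f \o shift x - (cst (f x) + l)) k = f (x + k) - f x - l k.
    by rewrite !fctE /= opprD addrA (addrC k).
  apply: le_trans (fl k) _; rewrite expr2 mulrA ler_wpM2r //.
  apply: (@le_trans _ _ ((1 + `|C|) * `|k|)).
    by rewrite ler_wpM2r // (le_trans (ler_norm C)) // lerDr.
  by rewrite mulrC -ler_pdivlMr ?ltr_wpDr.
have dl := diff_unique cl fx; split=> //.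
by apply/diff_locallyP; rewrite dl.
Qed.

Lemma jacobian_of_remainder (R : realType) (m n : nat) (f : 'rV[R]_m -> 'rV[R]_n)
    (M : 'M[R]_(m, n)) (x : 'rV[R]_m) (C : R) :
  (forall k, enorm (f (x + k) - f x - k *m M) <= C * enorm k ^+ 2) ->
  differentiable f x /\ 'J f x = M.
Proof.
move=> fM.
have [k|df fE] := @differentiable_of_remainder _ _ _ f (mulmxr M) x (`|C| * m%:R ^+ 2)
    (mx_linear_continuous (l := mulmxr M)).
  apply: le_trans (normr_le_enorm _) _; apply: le_trans (fM k) _.
  apply: le_trans (ler_wpM2r (sqr_ge0 _) (ler_norm C)) _.
  by rewrite -mulrA ler_wpM2l // -exprMn lerXn2r ?nnegrE ?enorm_ge0 ?mulr_ge0 //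
     enorm_le_normr.
split=> //; apply/row_matrixP => i.
by rewrite !rowE mul_rV_lin1 fE.
Qed.

Lemma grad_of_remainder (R : realType) (m : nat) (f : 'rV[R]_m -> R)
    (c : 'rV[R]_m) (x : 'rV[R]_m) (C : R) :
  (forall k, `|f (x + k) - f x - dot c k| <= C * enorm k ^+ 2) ->
  differentiable f x /\ grad f x = c.
Proof.
move=> fc.
have lin : linear (dot c : 'rV[R]_m -> R) by move=> a u v; rewrite dotDr dotZr.
pose lM := GRing.isLinear.Build _ _ _ _ _ lin.
pose l : {linear 'rV[R]_m -> R} := HB.pack (dot c) lM.
have [k|df fE] := @differentiable_of_remainder _ _ _ f l x (`|C| * m%:R ^+ 2)
    (mx_linear_continuous (l := l)).
  apply: le_trans (fc k) _.
  apply: le_trans (ler_wpM2r (sqr_ge0 _) (ler_norm C)) _.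
  by rewrite -mulrA ler_wpM2l // -exprMn lerXn2r ?nnegrE ?enorm_ge0 ?mulr_ge0 //
     enorm_le_normr.
split=> //; apply/rowP => i.
by rewrite mxE deriveE // fE -dot_delta.
Qed.

Lemma diff_grad (R : realType) (n : nat) (f : 'rV[R]_n -> R) (z v : 'rV[R]_n) :
  differentiable f z -> 'd f z v = dot (grad f z) v.
Proof.
move=> df; rewrite {1}(row_sum_delta v) linear_sum dotE.
by apply: eq_bigr => i _; rewrite linearZ /= mxE deriveE // mulrC.
Qed.

Lemma diff_jacobian (R : realType) (m n : nat) (f : 'rV[R]_m -> 'rV[R]_n)
    (z v : 'rV[R]_m) : 'd f z v = v *m 'J f z.
Proof. by rewrite /jacobian mul_rV_lin1. Qed.

(** * Derivatives along lines, and bounds obtained from them *)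

Lemma is_derive_line (R : realType) (V W : normedModType R) (F : V -> W)
    (l : {linear W -> R}) (z w : V) (s : R) :
  continuous l -> differentiable F (z + s *: w) ->
  is_derive s 1 (fun s => l (F (z + s *: w)) : R) (l ('d F (z + s *: w) w)).
Proof.
move=> cl dF.
have dline : is_diff s (fun s : R => z + s *: w) (fun s => s *: w).
  have -> : (fun s : R => z + s *: w) = cst z + *:%R^~ w by [].
  by apply: is_diff_eq; rewrite add0r.
have dlF : is_diff s (l \o (F \o (fun s : R => z + s *: w)))
    (l \o ('d F (z + s *: w) \o (fun s => s *: w))).
  apply: is_diff_comp; last first.
    by apply: DiffDef; [exact: linear_differentiable|exact: diff_lin].
  by apply: is_diff_comp; apply: differentiableP.
apply: DeriveDef; first exact/diff_derivable.
by rewrite deriveE // diff_val /= scale1r.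
Qed.

Lemma is_derive_of_remainder (R : realType) (f : R -> R) (c s C : R) :
  (forall t, `|f (s + t) - f s - t * c| <= C * t ^+ 2) -> is_derive s 1 f c.
Proof.
move=> fc.
have lin : linear (fun t : R^o => t * c : R^o).
  by move=> a u v; rewrite mulrDl -scalerAl.
pose lM := GRing.isLinear.Build _ _ _ _ _ lin.
pose l : {linear R^o -> R^o} := HB.pack (fun t : R^o => t * c : R^o) lM.
have [||df fE] := @differentiable_of_remainder _ R^o R^o f l s C.
- exact: mulrr_continuous.
- by move=> t; rewrite real_normK ?num_real //; exact: fc.
apply: DeriveDef; first exact/diff_derivable.
by rewrite deriveE // fE /= mul1r.
Qed.

Lemma is_derive_mulr (R : realType) (c s : R) : is_derive s 1 (fun t => t * c) c.
Proof.
apply: (@is_derive_of_remainder _ _ _ _ 0) => t.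
by rewrite mulrDl addrAC addrK subrr normr0 mul0r.
Qed.

Lemma MVT_le (R : realType) (f df : R -> R) (C : R) :
  (forall s : R, is_derive s 1 f (df s)) -> (forall s, 0 <= s <= 1 -> `|df s| <= C) ->
  `|f 1 - f 0| <= C.
Proof.
move=> fdf dfC; have cf : {within `[0, 1], continuous f}.
  by apply: derivable_within_continuous => t _.
have [c c01 ->] := MVT_segment ler01 (fun s _ => fdf s) cf.
by rewrite subr0 mulr1 dfC // !(itvP c01).
Qed.

(** All difference quotients at [s] are bounded by [M], hence so is their limit. This turns a
    Lipschitz bound on one derivative into a bound on the next. *)
Lemma derive_lipschitz_le (R : realType) (f : R -> R) (c s M : R) :
  is_derive s 1 f c -> (forall t, `|f (s + t) - f s| <= M * `|t|) -> `|c| <= M.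
Proof.
move=> fc fM; rewrite -(@derive_val _ _ _ _ _ _ _ fc).
have fs : derivable f s 1 by [].
have /cvg_norm cv := (fs : cvg _).
rewrite /derive -(cvg_lim _ cv) //.
apply: limr_le; first by apply/cvg_ex; eexists; exact: cv.
near=> h; have h0 : h != 0 by near: h; exact: nbhs_dnbhs_neq.
rewrite normrM normfV mulrC ler_pdivrMr ?normr_gt0 //=.
by rewrite [h *: 1]mulr1 (addrC h).
Unshelve. all: by end_near. Qed.

(** Let [s] tend to 0. Inequalities with a higher-order error are divided by their leading power of
    [s] and closed with this lemma. *)
Lemma le_of_forall_scale (R : realType) (a b c : R) :
  (forall s, 0 < s <= 1 -> a <= b + s * c) -> a <= b.
Proof.
move=> h; apply/ler_addgt0Pr => e e0.
have d0 : 0 < 1 + `|c| by rewrite ltr_wpDr.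
pose s := Num.min 1 (e / (1 + `|c|)).
have s0 : 0 < s by rewrite lt_min ltr01 divr_gt0.
apply: le_trans (h s _) _; first by rewrite s0 ge_min lexx.
rewrite lerD2l; apply: le_trans (ler_wpM2l (ltW s0) (ler_norm c)) _.
apply: (@le_trans _ _ (e / (1 + `|c|) * `|c|)).
  by rewrite ler_wpM2r // ge_min lexx orbT.
by rewrite -mulrA ger_pMr // mulrC ler_pdivrMr // mul1r lerDr.
Qed.

(** * Taylor bounds and symmetry of the Hessian *)

Lemma dot_mulmxBr (R : realType) (m n : nat) (p : 'rV[R]_m) (A B : 'M[R]_(m, n))
    (q : 'rV[R]_n) : dot (p *m (A - B)) q = dot (p *m A) q - dot (p *m B) q.
Proof. by rewrite mulmxBr dotBl. Qed.

Section Lines.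
Context (R : realType) (n : nat).
Implicit Types (f : 'rV[R]_n -> R) (z w p q : 'rV[R]_n).

Lemma is_derive_line_fun f z w (s : R) : differentiable1 f ->
  is_derive s 1 (fun s : R => f (z + s *: w)) (dot (grad f (z + s *: w)) w).
Proof.
move=> df; rewrite -diff_grad //.
by apply: (@is_derive_line _ _ R^o f idfun) => // x; exact: cvg_id.
Qed.

Lemma is_derive_line_grad f z w q (s : R) : differentiable2 f ->
  is_derive s 1 (fun s : R => dot (grad f (z + s *: w)) q)
    (dot (w *m hess f (z + s *: w)) q).
Proof.
move=> df; rewrite -diff_jacobian.
have lin : linear (fun u => dot u q) by move=> a u v; rewrite dotDl dotZl.
pose lM := GRing.isLinear.Build _ _ _ _ _ lin.
pose l : {linear 'rV[R]_n -> R} := HB.pack (fun u => dot u q) lM.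
by apply: (@is_derive_line _ _ _ (grad f) l) (df.2 _); exact: mx_linear_continuous.
Qed.

Lemma is_derive_line_hess f z w p q (s : R) : differentiable3 f ->
  is_derive s 1 (fun s : R => dot (p *m hess f (z + s *: w)) q)
    (dot (p *m third f (z + s *: w) w) q).
Proof.
move=> df; have lin : linear (fun A : 'M[R]_n => dot (p *m A) q).
  by move=> a u v; rewrite mulmxDr -scalemxAr dotDl dotZl.
pose lM := GRing.isLinear.Build _ _ _ _ _ lin.
pose l : {linear 'M[R]_n -> R} := HB.pack (fun A : 'M[R]_n => dot (p *m A) q) lM.
by apply: (@is_derive_line _ _ _ (hess f) l) (df.2 _); exact: mx_linear_continuous.
Qed.

End Lines.

Section Bounds.
Context (R : realType) (n : nat).
Implicit Types (f g : 'rV[R]_n -> R) (z w p q : 'rV[R]_n).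

Lemma exists_enorm_gt0 : (0 < n)%N -> exists e : 'rV[R]_n, 0 < enorm e.
Proof.
move=> n0; exists (const_mx 1); apply: enorm_gt0.
apply/eqP => /matrixP/(_ 0 (Ordinal n0))/eqP.
by rewrite !mxE oner_eq0.
Qed.

Lemma lipschitz_cst_ge0 (d : 'rV[R]_n -> 'rV[R]_n -> R) (L : R) : (0 < n)%N ->
  (forall z z', 0 <= d z z') -> (forall z z', d z z' <= L * enorm (z - z')) -> 0 <= L.
Proof.
move=> /exists_enorm_gt0[e e0] d0 dL.
have /(le_trans (d0 _ _)) := dL e 0.
by rewrite subr0 pmulr_lge0.
Qed.

Lemma hess_lipschitz f rho z z' p q : lipschitz_hess rho f ->
  `|dot (p *m (hess f z - hess f z')) q| <= rho * enorm (z - z') * enorm p * enorm q.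
Proof.
move=> [_ fr]; apply: le_trans (dot_mulmx_le _ _ _) _.
by rewrite !ler_wpM2r ?enorm_ge0.
Qed.

Lemma thirdP f z a u v : third f z (a *: u + v) = a *: third f z u + third f z v.
Proof. exact: linearP. Qed.

Lemma thirdB f z u v : third f z (u - v) = third f z u - third f z v.
Proof. exact: linearB. Qed.

Lemma third_lipschitz f nu z z' u p q : lipschitz_third nu f ->
  `|dot (p *m (third f z u - third f z' u)) q|
    <= nu * enorm (z - z') * enorm u * enorm p * enorm q.
Proof.
move=> [_ fr].
have lin : linear (fun u => third f z u - third f z' u).
  by move=> a v w; rewrite !thirdP scalerBr opprD addrACA.
pose lM := GRing.isLinear.Build _ _ _ _ _ lin.
pose T : {linear 'rV[R]_n -> 'M[R]_n} := HB.pack (fun u => third f z u - third f z' u) lM.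
apply: le_trans (dot_mulmx_le3 T u p q) _.
by rewrite !ler_wpM2r ?enorm_ge0 //; exact: fr.
Qed.

(** A nonzero vector in all three slots fixes the sign; in dimension 0 the constant could be
    negative. *)
Lemma lipschitz_third_ge0 f nu : (0 < n)%N -> lipschitz_third nu f -> 0 <= nu.
Proof.
move=> n0 fn; have [e e0] := exists_enorm_gt0 n0.
rewrite -(pmulr_lge0 nu (exprn_gt0 3 e0)).
apply: (@lipschitz_cst_ge0 (fun z z' => `|dot (e *m (third f z e - third f z' e)) e|))
  => // z z'.
apply: le_trans (third_lipschitz _ _ _ _ _ fn) _.
by rewrite le_eqVlt; apply/orP; left; apply/eqP; ring.
Qed.

Lemma hess_bounded f L z p q : differentiable2 f -> lipschitz_grad L f ->
  `|dot (p *m hess f z) q| <= L * enorm p * enorm q.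
Proof.
move=> df [_ fL]; have := is_derive_line_grad z p q 0 df; rewrite scale0r addr0 => d.
apply: (derive_lipschitz_le d) => t; rewrite scale0r !add0r addr0 -dotBl.
apply: le_trans (normr_dot_le _ _) _.
rewrite [leRHS]mulrAC ler_wpM2r ?enorm_ge0 //; apply: le_trans (fL _ _) _.
by rewrite [z + _]addrC addrK enormZ -mulrA (mulrC (enorm p)).
Qed.

Lemma third_bounded f rho z u p q : differentiable3 f -> lipschitz_hess rho f ->
  `|dot (p *m third f z u) q| <= rho * enorm u * enorm p * enorm q.
Proof.
move=> df fr; have := is_derive_line_hess z u p q 0 df; rewrite scale0r addr0 => d.
apply: (derive_lipschitz_le d) => t; rewrite scale0r !add0r addr0 -dotBl -mulmxBr.
apply: le_trans (hess_lipschitz _ _ _ _ fr) _.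
rewrite [z + _]addrC addrK enormZ le_eqVlt; apply/orP; left; apply/eqP; ring.
Qed.

(** The factor 1/2 of the sharp estimate is given up, since no Taylor remainder constant enters
    [D5]. *)
Lemma taylor1 f L z w : 0 <= L -> lipschitz_grad L f ->
  `|f (z + w) - f z - dot (grad f z) w| <= L * enorm w ^+ 2.
Proof.
move=> L0 [df fL].
pose phi (s : R) := f (z + s *: w) - s * dot (grad f z) w.
pose dphi (s : R) := dot (grad f (z + s *: w)) w - dot (grad f z) w.
have -> : f (z + w) - f z - dot (grad f z) w = phi 1 - phi 0.
  by rewrite /phi scale1r scale0r mul1r mul0r addr0 subr0 addrAC.
apply: (@MVT_le _ _ dphi) => [s|s /andP[s0 s1]].
  apply: is_deriveB; first exact: is_derive_line_fun.
  exact: is_derive_mulr.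
rewrite /dphi -dotBl; apply: le_trans (normr_dot_le _ _) _.
rewrite expr2 mulrA ler_wpM2r ?enorm_ge0 //; apply: le_trans (fL _ _) _.
by rewrite [z + _]addrC addrK enormZ ger0_norm // ler_wpM2l // ler_piMl ?enorm_ge0.
Qed.

Lemma taylor2 f rho z w q : 0 <= rho -> lipschitz_hess rho f ->
  `|dot (grad f (z + w) - grad f z - w *m hess f z) q| <= rho * enorm w ^+ 2 * enorm q.
Proof.
move=> r0 fr; have [df _] := fr.
pose phi (s : R) := dot (grad f (z + s *: w)) q - s * dot (w *m hess f z) q.
pose dphi (s : R) := dot (w *m hess f (z + s *: w)) q - dot (w *m hess f z) q.
have -> : dot (grad f (z + w) - grad f z - w *m hess f z) q = phi 1 - phi 0.
  by rewrite /phi scale1r scale0r mul1r mul0r addr0 subr0 !dotBl addrAC.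
apply: (@MVT_le _ _ dphi) => [s|s /andP[s0 s1]].
  apply: is_deriveB; first exact: is_derive_line_grad.
  exact: is_derive_mulr.
rewrite /dphi -dotBl -mulmxBr; apply: le_trans (hess_lipschitz _ _ _ _ fr) _.
rewrite [z + _]addrC addrK enormZ ger0_norm // expr2 [rho * (enorm w * _)]mulrA.
by rewrite !ler_wpM2r ?enorm_ge0 // ler_wpM2l // ler_piMl ?enorm_ge0.
Qed.

(** Move along the segments from [b'] to [a'] and from [b] to [a] simultaneously. The derivative is
    a difference of third derivatives at two base points and in two directions: changing the base
    point costs the [nu] term, changing the direction the [rho] term. *)
Lemma hess_second_difference f rho nu a a' b b' p q D : 0 <= rho -> 0 <= nu ->
  lipschitz_hess rho f -> lipschitz_third nu f ->
  enorm (a' - a) <= D -> enorm (b' - b) <= D ->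
  `|dot (p *m (hess f a' - hess f a - (hess f b' - hess f b))) q|
    <= (nu * D * enorm (a' - b') + rho * enorm (a' - a - (b' - b))) * enorm p * enorm q.
Proof.
move=> r0 n0 fr fn aD bD; have [df _] := fn.
pose phi (s : R) := dot (p *m hess f (b' + s *: (a' - b'))) q
                    - dot (p *m hess f (b + s *: (a - b))) q.
pose dphi (s : R) := dot (p *m third f (b' + s *: (a' - b')) (a' - b')) q
                     - dot (p *m third f (b + s *: (a - b)) (a - b)) q.
have -> : dot (p *m (hess f a' - hess f a - (hess f b' - hess f b))) q = phi 1 - phi 0.
  rewrite /phi !scale1r !scale0r !addr0 !subrKC.
  by move: (hess f _) (hess f _) (hess f _) (hess f _) => *; rewrite !dot_mulmxBr.
apply: (@MVT_le _ _ dphi) => [s|s /andP[s0 s1]].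
  by apply: is_deriveB; exact: is_derive_line_hess.
have -> : dphi s
  = dot (p *m (third f (b' + s *: (a' - b')) (a' - b')
               - third f (b + s *: (a - b)) (a' - b'))) q
  + dot (p *m third f (b + s *: (a - b)) (a' - a - (b' - b))) q.
  have -> : a' - a - (b' - b) = (a' - b') - (a - b).
    by apply/rowP => i; rewrite !mxE; ring.
  rewrite (thirdB _ _ (a' - b')) /dphi.
  move: (third f _ _) (third f _ _) (third f _ _) => *.
  by rewrite !dot_mulmxBr; ring.
apply: le_trans (ler_normD _ _) _; rewrite !mulrDl lerD //; last first.
  exact: third_bounded.
apply: le_trans (third_lipschitz _ _ _ _ _ fn) _.
rewrite !ler_wpM2r ?enorm_ge0 // ler_wpM2l //.
(* The difference of the moving points is a convex combination of [a' - a] and [b' - b], so [D]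
   bounds it for every [s]. *)
have -> : b' + s *: (a' - b') - (b + s *: (a - b))
    = s *: (a' - a) + (1 - s) *: (b' - b).
  by apply/rowP => i; rewrite !mxE; ring.
apply: le_trans (enormD _ _) _; rewrite !enormZ !ger0_norm ?subr_ge0 //.
have -> : D = s * D + (1 - s) * D by ring.
by rewrite lerD // ler_wpM2l ?subr_ge0.
Qed.

(* The mixed second difference of [f] along [u] and [v] does not depend on the
   order of [u] and [v], and is approximated by both sides. *)
Lemma hess_sym f rho z u v : 0 <= rho -> lipschitz_hess rho f ->
  dot (u *m hess f z) v = dot (v *m hess f z) u.
Proof.
move=> r0 fr; have [df _] := fr.
pose Delta p q : R := f (z + p + q) - f (z + p) - (f (z + q) - f z).
pose K p q := enorm p ^+ 2 * enorm q + enorm p * enorm q ^+ 2.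
have approx p q : `|Delta p q - dot (p *m hess f z) q| <= rho * K p q.
  pose phi (s : R) := f (z + p + s *: q) - f (z + s *: q) - s * dot (p *m hess f z) q.
  pose dphi (s : R) := dot (grad f (z + p + s *: q)) q - dot (grad f (z + s *: q)) q
                      - dot (p *m hess f z) q.
  have -> : Delta p q - dot (p *m hess f z) q = phi 1 - phi 0.
    by rewrite /phi /Delta !scale1r !scale0r !addr0 mul1r mul0r; ring.
  apply: (@MVT_le _ _ dphi) => [s|s /andP[s0 s1]].
    apply: is_deriveB.
      by apply: is_deriveB; apply: is_derive_line_fun; exact: df.1.
    exact: is_derive_mulr.
  have -> : dphi s =
      dot (grad f (z + s *: q + p) - grad f (z + s *: q) - p *m hess f (z + s *: q)) q
      + dot (p *m (hess f (z + s *: q) - hess f z)) q.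
    rewrite /dphi (addrAC z (s *: q)); move: (hess f _) (hess f _) => *.
    by rewrite dot_mulmxBr !dotBl; ring.
  apply: le_trans (ler_normD _ _) _; rewrite /K mulrDr lerD //.
    by rewrite mulrA; exact: taylor2.
  apply: le_trans (hess_lipschitz _ _ _ _ fr) _.
  rewrite [z + _]addrC addrK enormZ ger0_norm // -!mulrA ler_wpM2l //.
  by rewrite (mulrCA (enorm q)) -expr2 ler_piMl ?mulr_ge0 ?exprn_ge0 ?enorm_ge0.
have DeltaC p q : Delta p q = Delta q p by rewrite /Delta (addrAC z); ring.
have diff p q : `|dot (p *m hess f z) q - dot (q *m hess f z) p| <= rho * (K p q + K q p).
  have := approx p q; have := approx q p; rewrite DeltaC.
  rewrite !ler_norml !mulrDr; lra.
suff : forall p q, dot (p *m hess f z) q <= dot (q *m hess f z) p.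
  by move=> le; apply/eqP; rewrite eq_le !le.
(* Scaling both vectors by [s] multiplies the bilinear forms by [s ^+ 2] and the error by
   [s ^+ 3]. *)
move=> p q; apply: (@le_of_forall_scale _ _ _ (rho * (K p q + K q p))) => s /andP[s0 _].
have := diff (s *: p) (s *: q); rewrite /K !enormZ !(gtr0_norm s0).
rewrite -!scalemxAl !dotZl !dotZr => /(le_trans (ler_norm _)) h.
rewrite -(ler_pM2l (mulr_gt0 s0 s0)).
lra.
Qed.

End Bounds.

(** * The lower-level problem *)

(** The quadratic bound keeps [h] above [h 0] outside a compact ball, on which [h] attains its
    minimum. Hence [argmin] is a minimizer and not the default point. *)
Lemma coercive_argminP (R : realType) (n : nat) (h : 'rV[R]_n -> R) (a m : R) :
  0 < m -> continuous h -> (forall y, h 0 - a * enorm y + m * enorm y ^+ 2 <= h y) ->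
  forall y, h (argmin h) <= h y.
Proof.
move=> m0 ch hge; rewrite /argmin.
suff /getPex : exists y, [set y | forall y', h y <= h y'] y by [].
(* Beyond this radius the quadratic term dominates the linear one. *)
pose r := `|a| / m; pose A := [set y : 'rV[R]_n | `|y| <= r].
have r0 : 0 <= r by rewrite divr_ge0 // ltW.
have A0 : A 0 by rewrite /A /= normr0.
have [||y yA hy] := @EVT_min_rV _ _ h A (ex_intro _ 0 A0).
- apply: bounded_closed_compact.
    by exists r; split; [exact: num_real|move=> s rs y /= /le_trans; apply; exact: ltW].
  apply: (@closed_comp _ _ (fun y : 'rV[R]_n => `|y|) [set s | s <= r]).
    by move=> y _; exact: norm_continuous.
  exact: closed_le.
- exact: continuous_subspaceT.
exists y => y'; have [y'r|y'r] := leP `|y'| r; first by apply: hy; rewrite inE.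
apply: le_trans (hy 0 _) _; first by rewrite inE.
apply: le_trans (hge y'); rewrite -addrA lerDl expr2 mulrA addrC -mulrBl.
rewrite mulr_ge0 ?enorm_ge0 // subr_ge0 mulrC -ler_pdivrMr //.
apply: le_trans (ltW (lt_le_trans y'r (normr_le_enorm y'))).
by rewrite ler_wpM2r ?invr_ge0 ?(ltW m0) // ler_norm.
Qed.

Lemma enorm_le_of_coercive (R : realType) (m c : R) (n : nat) (u : 'rV[R]_n) :
  0 < m -> 0 <= c -> m * enorm u ^+ 2 <= c * enorm u -> enorm u <= c / m.
Proof.
move=> m0 c0; have [->|u0] := eqVneq u 0; first by rewrite enorm0 divr_ge0 // ltW.
rewrite expr2 mulrA ler_pM2r ?enorm_gt0 // mulrC => h.
by rewrite ler_pdivlMr.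
Qed.

(* [G] and [H] are the gradient and Hessian of the lower-level objective, and
   [y] selects a critical point in the second block. *)
Record inner_problem (R : realType) (dx dy : nat)
    (G : 'rV[R]_(dx + dy) -> 'rV[R]_(dx + dy))
    (H : 'rV[R]_(dx + dy) -> 'M[R]_(dx + dy))
    (y : 'rV[R]_dx -> 'rV[R]_dy) (L m K : R) : Prop := InnerProblem {
  inner_m_gt0 : 0 < m;
  inner_L_ge0 : 0 <= L;
  inner_K_ge0 : 0 <= K;
  inner_G_lipschitz : forall z z', enorm (G z - G z') <= L * enorm (z - z');
  inner_G_taylor : forall z w q,
    `|dot (G (z + w) - G z - w *m H z) q| <= K * enorm w ^+ 2 * enorm q;
  inner_H_bounded : forall z p q, `|dot (p *m H z) q| <= L * enorm p * enorm q;
  inner_H_sym : forall z p q, dot (p *m H z) q = dot (q *m H z) p;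
  inner_G_monotone : forall x (eta eta' : 'rV[R]_dy),
    m * enorm (eta - eta') ^+ 2
      <= dot (G (row_mx x eta) - G (row_mx x eta')) (row_mx 0 (eta - eta'));
  inner_critical : forall x eta, dot (G (row_mx x (y x))) (row_mx 0 eta) = 0
}.

Section Inner.
Context (R : realType) (dx dy : nat).
Context (G : 'rV[R]_(dx + dy) -> 'rV[R]_(dx + dy)).
Context (H : 'rV[R]_(dx + dy) -> 'M[R]_(dx + dy)).
Context (y : 'rV[R]_dx -> 'rV[R]_dy) (L m K : R).
Implicit Types (x k v : 'rV[R]_dx) (eta : 'rV[R]_dy) (z p q : 'rV[R]_(dx + dy)).

Hypothesis GHy : inner_problem G H y L m K.

Let m_gt0 := inner_m_gt0 GHy.
Let L_ge0 := inner_L_ge0 GHy.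
Let K_ge0 := inner_K_ge0 GHy.
Let G_lipschitz := inner_G_lipschitz GHy.
Let G_taylor := inner_G_taylor GHy.
Let H_bounded := inner_H_bounded GHy.
Let H_sym := inner_H_sym GHy.
Let G_monotone := inner_G_monotone GHy.
Let y_critical := inner_critical GHy.

Definition graph_at x : 'rV[R]_(dx + dy) := row_mx x (y x).

Lemma graph_at_sub x x' : graph_at x' - graph_at x = row_mx (x' - x) (y x' - y x).
Proof. by rewrite /graph_at opp_row_mx add_row_mx. Qed.

(** Apply monotonicity of [G] to a vertical step [s *: eta], expand by Taylor, divide by [s ^+ 2]
    and let [s] tend to 0. *)
Lemma H_coercive z eta :
  m * enorm eta ^+ 2 <= dot (row_mx 0 eta *m H z) (row_mx 0 eta).
Proof.
apply: (@le_of_forall_scale _ _ _ (K * enorm eta ^+ 3)) => s /andP[s0 _].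
have := G_monotone (lsubmx z) (rsubmx z + s *: eta) (rsubmx z).
have -> : row_mx (lsubmx z) (rsubmx z + s *: eta) = z + s *: row_mx (0 : 'rV_dx) eta.
  by rewrite -{3}[z]hsubmxK scale_row_mx add_row_mx scaler0 addr0.
rewrite hsubmxK [rsubmx z + _]addrC addrK enormZ gtr0_norm //.
have -> : row_mx (0 : 'rV_dx) (s *: eta) = s *: row_mx 0 eta.
  by rewrite scale_row_mx scaler0.
have := G_taylor z (s *: row_mx 0 eta) (s *: row_mx 0 eta).
rewrite !enormZ enorm_row_mx0 (gtr0_norm s0) -scalemxAl.
move=> /(le_trans (ler_norm _)); rewrite !dotBl dotZl !dotZr => h1 h2.

rewrite -(ler_pM2l (mulr_gt0 s0 s0)); lra.
Qed.

Lemma inner_lipschitz x x' : enorm (y x' - y x) <= L / m * enorm (x' - x).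
Proof.
have -> : L / m * enorm (x' - x) = L * enorm (x' - x) / m by rewrite mulrAC.
apply: enorm_le_of_coercive => //; first by rewrite mulr_ge0 ?enorm_ge0.
apply: le_trans (G_monotone x' (y x') (y x)) _.
(* Criticality at [x] inserts a zero term, so that [G] is compared at two points with the same
   second block [y x]. *)
rewrite dotBl y_critical sub0r -[X in - X]subr0 -(y_critical x (y x' - y x)).
rewrite -dotBl -dotNl opprB.
apply: le_trans (dot_le _ _) _; rewrite enorm_row_mx0 ler_wpM2r ?enorm_ge0 //.
apply: le_trans (G_lipschitz _ _) _.
by rewrite opp_row_mx add_row_mx subrr enorm_row_mx_0 enormB.
Qed.

Lemma graph_at_lipschitz x x' : enorm (graph_at x' - graph_at x) <= (1 + L / m) * enorm (x' - x).
Proof.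
rewrite graph_at_sub mulrDl mul1r; apply: le_trans (enorm_row_mx_le _ _) _.
by rewrite lerD2l inner_lipschitz.
Qed.

(** The implicit function formula for the derivative of [y], in the row vector convention. [invmx]
    is total; [drsubmx_unit] justifies the inverse. *)
Definition inner_jacobian x : 'M[R]_(dx, dy) :=
  - (ursubmx (H (graph_at x)) *m invmx (drsubmx (H (graph_at x)))).

Definition tangent x : 'M[R]_(dx, dx + dy) := row_mx 1%:M (inner_jacobian x).

Lemma mul_tangent x v : v *m tangent x = row_mx v (v *m inner_jacobian x).
Proof. by rewrite /tangent mul_mx_row mulmx1. Qed.

Lemma mul_row_mx_submx (A : 'M[R]_(dx + dy)) v eta :
  row_mx v eta *m A = row_mx (v *m ulsubmx A + eta *m dlsubmx A)
                            (v *m ursubmx A + eta *m drsubmx A).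
Proof. by rewrite -{1}[A]submxK mul_row_block. Qed.

(** A kernel vector has zero energy, so coercivity makes it 0. *)
Lemma drsubmx_unit z : drsubmx (H z) \in unitmx.
Proof.
rewrite -row_free_unit -kermx_eq0; apply/eqP/row_matrixP => i; rewrite row0.
set eta := row i _; have eta0 : eta *m drsubmx (H z) = 0.
  by rewrite /eta -row_mul mulmx_ker row0.
have := H_coercive z eta.
rewrite mul_row_mx_submx dot_row_mx dot0r add0r eta0 mul0mx addr0 dot0l.
by rewrite pmulr_rle0 // => h; apply: enorm_eq0; apply/eqP;
   rewrite -sqrf_eq0 eq_le h sqr_ge0.
Qed.

(* Differentiating [inner_critical]: the graph direction is [H]-orthogonal to the
   vertical directions. *)
Lemma tangent_orthogonal x v eta :
  dot (v *m tangent x *m H (graph_at x)) (row_mx 0 eta) = 0.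
Proof.
rewrite mul_tangent mul_row_mx_submx dot_row_mx dot0r add0r.
rewrite /inner_jacobian mulmxN mulNmx -!mulmxA mulVmx ?drsubmx_unit // mulmx1.
by rewrite subrr dot0l.
Qed.

(** By orthogonality, [- row_mx v 0] may replace the vertical vector in one slot of its energy,
    which the bound on [H] then controls. *)
Lemma inner_jacobian_bounded x v : enorm (v *m inner_jacobian x) <= L / m * enorm v.
Proof.
have -> : L / m * enorm v = L * enorm v / m by rewrite mulrAC.
apply: enorm_le_of_coercive => //; first by rewrite mulr_ge0 ?enorm_ge0.
set eta := v *m _; apply: le_trans (H_coercive (graph_at x) eta) _.
have -> : row_mx 0 eta = v *m tangent x - row_mx v 0.
  by rewrite mul_tangent opp_row_mx add_row_mx subrr subr0.
rewrite {1}mulmxBl dotBl.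
have -> : v *m tangent x - row_mx v 0 = row_mx 0 eta.
  by rewrite mul_tangent opp_row_mx add_row_mx subrr subr0.
rewrite tangent_orthogonal sub0r -dotNl -mulNmx; apply: le_trans (ler_norm _) _.
by apply: le_trans (H_bounded _ _ _) _; rewrite enormN enorm_row_mx_0 enorm_row_mx0.
Qed.

(** [G] is vertically critical at both graph points, so by Taylor [H] of the graph increment is
    vertically small. Orthogonality removes the tangent part of the increment, and coercivity bounds
    what is left. *)
Lemma inner_taylor x k :
  enorm (y (x + k) - y x - k *m inner_jacobian x)
    <= K * (1 + L / m) ^+ 2 / m * enorm k ^+ 2.
Proof.
rewrite [leRHS]mulrAC; set eta := _ - _ - _.
have Km : 0 <= K * (1 + L / m) ^+ 2 * enorm k ^+ 2.
  by rewrite mulr_ge0 ?sqr_ge0 // mulr_ge0 ?sqr_ge0.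
apply: enorm_le_of_coercive => //.
apply: le_trans (H_coercive (graph_at x) eta) _.
set w := graph_at (x + k) - graph_at x.
have wk : w = row_mx k (y (x + k) - y x) by rewrite /w graph_at_sub [x + _]addrC addrK.
have -> : dot (row_mx 0 eta *m H (graph_at x)) (row_mx 0 eta)
   = dot (w *m H (graph_at x)) (row_mx 0 eta).
  rewrite -[RHS]subr0 -(tangent_orthogonal x k eta) -dotBl -mulmxBl.
  by rewrite wk mul_tangent opp_row_mx add_row_mx subrr.
have := G_taylor (graph_at x) w (row_mx 0 eta).
rewrite subrKC !dotBl !y_critical subrr sub0r normrN enorm_row_mx0.
move=> /(le_trans (ler_norm _))/le_trans; apply.
rewrite ler_wpM2r ?enorm_ge0 // -mulrA ler_wpM2l // -exprMn.
rewrite lerXn2r ?nnegrE ?enorm_ge0 ?mulr_ge0 ?enorm_ge0 ?addr_ge0 ?divr_ge0 ?(ltW m_gt0) //.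
by apply: le_trans (graph_at_lipschitz _ _) _; rewrite [x + _]addrC addrK.
Qed.

(** Envelope theorem: on the graph the gradient has no vertical part, so the motion of the minimizer
    counts only to second order. *)
Lemma envelope_taylor (h : 'rV[R]_(dx + dy) -> R) x k :
  (forall z w, `|h (z + w) - h z - dot (G z) w| <= L * enorm w ^+ 2) ->
  `|h (graph_at (x + k)) - h (graph_at x) - dot (lsubmx (G (graph_at x))) k|
    <= L * (1 + L / m) ^+ 2 * enorm k ^+ 2.
Proof.
move=> hG; set w := graph_at (x + k) - graph_at x.
have wk : w = row_mx k (y (x + k) - y x) by rewrite /w graph_at_sub [x + _]addrC addrK.
have := hG (graph_at x) w; rewrite subrKC dot_lsubmx.
have -> : dot (G (graph_at x)) w = dot (G (graph_at x)) (row_mx k 0).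
  rewrite -[RHS]addr0 -(y_critical x (y (x + k) - y x)) -dotDr wk.
  by rewrite add_row_mx addr0 add0r.
move=> /le_trans; apply; rewrite -mulrA ler_wpM2l // -exprMn.
rewrite lerXn2r ?nnegrE ?enorm_ge0 ?mulr_ge0 ?enorm_ge0 ?addr_ge0 ?divr_ge0 ?(ltW m_gt0) //.
by apply: le_trans (graph_at_lipschitz _ _) _; rewrite [x + _]addrC addrK.
Qed.

(** This is the Schur complement [H_xx - H_xy H_yy^-1 H_yx]. *)
Definition envelope_hess x : 'M[R]_dx := tangent x *m lsubmx (H (graph_at x)).

Lemma dot_envelope_hess x v (u : 'rV[R]_dx) :
  dot (v *m envelope_hess x) u = dot (v *m tangent x *m H (graph_at x)) (row_mx u 0).
Proof.
rewrite /envelope_hess mulmxA -dot_lsubmx; congr (dot _ u).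
move: (v *m tangent x) => t.
by rewrite -[X in _ = lsubmx (_ *m X)]hsubmxK mul_mx_row row_mxKl.
Qed.

(** Two quadratic errors add up: the Taylor remainder of [G] along the graph, and [H] applied to the
    deviation of the graph from its tangent. *)
Lemma envelope_grad_taylor x k :
  enorm (lsubmx (G (graph_at (x + k))) - lsubmx (G (graph_at x)) - k *m envelope_hess x)
    <= (K * (1 + L / m) ^+ 2 + L * (K * (1 + L / m) ^+ 2 / m)) * enorm k ^+ 2.
Proof.
have Lm : 0 <= 1 + L / m by rewrite addr_ge0 ?divr_ge0 ?(ltW m_gt0).
have c0 : 0 <= K * (1 + L / m) ^+ 2 by rewrite mulr_ge0 ?sqr_ge0.
have c1 : 0 <= K * (1 + L / m) ^+ 2 / m by rewrite divr_ge0 // ltW.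
apply: enorm_dual_le => [|q].
  by rewrite mulr_ge0 ?sqr_ge0 // addr_ge0 // mulr_ge0.
rewrite !dotBl dot_envelope_hess !dot_lsubmx.
set w := graph_at (x + k) - graph_at x.
have wk : w = row_mx k (y (x + k) - y x) by rewrite /w graph_at_sub [x + _]addrC addrK.
have := G_taylor (graph_at x) w (row_mx q 0).
rewrite subrKC !dotBl enorm_row_mx_0 => /(le_trans (ler_norm _)) h1.
have := H_bounded (graph_at x) (w - k *m tangent x) (row_mx q 0).
rewrite mulmxBl dotBl enorm_row_mx_0 => /(le_trans (ler_norm _)) h2.
have wT : enorm (w - k *m tangent x) <= K * (1 + L / m) ^+ 2 / m * enorm k ^+ 2.
  rewrite wk mul_tangent opp_row_mx add_row_mx subrr enorm_row_mx0.
  exact: inner_taylor.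
have w2 : enorm w ^+ 2 <= (1 + L / m) ^+ 2 * enorm k ^+ 2.
  rewrite -exprMn lerXn2r ?nnegrE ?enorm_ge0 ?mulr_ge0 ?enorm_ge0 //.
  by apply: le_trans (graph_at_lipschitz _ _) _; rewrite [x + _]addrC addrK.
apply: (@le_trans _ _ (K * enorm w ^+ 2 * enorm q
    + L * enorm (w - k *m tangent x) * enorm q)); first by lra.
rewrite -mulrDl ler_wpM2r ?enorm_ge0 // mulrDl.
by rewrite lerD // -[leRHS]mulrA ler_wpM2l.
Qed.

(* The tangents at [x] and [x'] differ by vertical vectors, so by orthogonality both
   Hessians can be paired with the same two vectors. *)
Lemma envelope_hess_sub x x' v (u : 'rV[R]_dx) :
  dot (v *m (envelope_hess x - envelope_hess x')) u
  = dot (v *m tangent x *m (H (graph_at x) - H (graph_at x'))) (u *m tangent x').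
Proof.
have vert (a : 'rV[R]_dx) x1 x2 : a *m tangent x1
   = a *m tangent x2 + row_mx 0 (a *m inner_jacobian x1 - a *m inner_jacobian x2).
  by rewrite !mul_tangent add_row_mx addr0 subrKC.
have hor (a : 'rV[R]_dx) x1 : row_mx a 0
   = a *m tangent x1 + row_mx 0 (- (a *m inner_jacobian x1)).
  by rewrite mul_tangent add_row_mx addr0 subrr.
rewrite !dot_mulmxBr !dot_envelope_hess; congr (_ - _).
  by rewrite (hor u x') dotDr tangent_orthogonal addr0.
rewrite (hor u x') dotDr tangent_orthogonal addr0.
(* The vector to be changed sits in the left slot; symmetry moves it to the right, where
   orthogonality at [x'] removes its vertical part. *)
by rewrite [RHS]H_sym (vert v x x') dotDr tangent_orthogonal addr0 H_sym.
Qed.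

End Inner.

(** * Strong convexity *)

Section LowerLevel.
Context (R : realType) (dx dy : nat).
Implicit Types (f g : 'rV[R]_(dx + dy) -> R) (x : 'rV[R]_dx) (y eta : 'rV[R]_dy).

Lemma row_mx_sub x y y' : row_mx x y' - row_mx x y = row_mx 0 (y' - y).
Proof. by rewrite opp_row_mx add_row_mx subrr. Qed.

Lemma row_mx_shift x y eta : row_mx x (y + eta) = row_mx x y + row_mx 0 eta.
Proof. by rewrite add_row_mx addr0. Qed.

Lemma row_mx0_scale (s : R) eta : row_mx (0 : 'rV[R]_dx) (s *: eta) = s *: row_mx 0 eta.
Proof. by rewrite scale_row_mx scaler0. Qed.

Lemma continuous_partial f x : differentiable1 f -> continuous (fun y => f (row_mx x y)).
Proof.
move=> df y.
have -> : (fun y => f (row_mx x y))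
    = f \o (fun y => row_mx x 0 + mulmxr (row_mx 0 1%:M) y).
  apply/funext => u /=; congr f.
  by rewrite mul_mx_row mulmx0 mulmx1 add_row_mx addr0 add0r.
apply: continuous_comp; last exact: differentiable_continuous.
apply: continuousD; first exact: cst_continuous.
exact: mx_linear_continuous.
Qed.

(** First-order test along [eta] and [- eta]. *)
Lemma minimizer_critical (h : 'rV[R]_(dx + dy) -> R) (c : 'rV[R]_(dx + dy)) (C : R) x y :
  (forall w, `|h (row_mx x y + w) - h (row_mx x y) - dot c w| <= C * enorm w ^+ 2) ->
  (forall y', h (row_mx x y) <= h (row_mx x y')) ->
  forall eta, dot c (row_mx 0 eta) = 0.
Proof.
move=> hc hy.
have ge0 eta : 0 <= dot c (row_mx 0 eta).
  apply: (@le_of_forall_scale _ _ _ (C * enorm eta ^+ 2)) => s /andP[s0 _].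
  have := hy (y + s *: eta); rewrite row_mx_shift row_mx0_scale => h1.
  have := hc (s *: row_mx 0 eta); rewrite dotZr enormZ enorm_row_mx0 (gtr0_norm s0).
  rewrite ler_norml => /andP[_ h2]; rewrite -(ler_pM2l s0); nra.
move=> eta; apply/eqP; rewrite eq_le ge0 andbT -oppr_ge0 -dotNr.
by rewrite opp_row_mx oppr0 ge0.
Qed.

(** Divide the convexity inequality at [y' + s *: (y - y')] by [s] and let [s] tend to 0. In the
    error, [L] comes from the Taylor remainder and [mu / 2] from the factor [1 - s]. *)
Lemma strongly_convex_first_order g mu L x y y' : 0 <= L -> lipschitz_grad L g ->
  strongly_convex mu (fun y => g (row_mx x y)) ->
  g (row_mx x y') + dot (grad g (row_mx x y')) (row_mx 0 (y - y'))
    + mu / 2 * enorm (y - y') ^+ 2 <= g (row_mx x y).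
Proof.
move=> L0 gL gmu.
apply: (@le_of_forall_scale _ _ _ ((L + mu / 2) * enorm (y - y') ^+ 2)) => s /andP[s0 s1].
have := gmu y y' s; rewrite s1 ltW // => /(_ isT).
have -> : s *: y + (1 - s) *: y' = y' + s *: (y - y').
  by apply/rowP => i; rewrite !mxE; ring.
have := taylor1 (row_mx x y') (s *: row_mx 0 (y - y')) L0 gL.
rewrite row_mx_shift row_mx0_scale dotZr enormZ enorm_row_mx0 (gtr0_norm s0).
rewrite ler_norml => /andP[h1 _] h2; rewrite -(ler_pM2l s0); nra.
Qed.

Lemma strongly_convex_monotone g mu L x y y' : 0 <= L -> lipschitz_grad L g ->
  strongly_convex mu (fun y => g (row_mx x y)) ->
  mu * enorm (y - y') ^+ 2
    <= dot (grad g (row_mx x y) - grad g (row_mx x y')) (row_mx 0 (y - y')).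
Proof.
move=> L0 gL gmu; rewrite dotBl.
have := strongly_convex_first_order y y' L0 gL gmu.
have := strongly_convex_first_order y' y L0 gL gmu.
rewrite (enormB y' y) -(opprB y y') -[X in row_mx X (- _)]oppr0 -opp_row_mx dotNr.
lra.
Qed.

Lemma vertical_grad_bounded f Cf z eta : differentiable1 f -> lipschitz_in_y Cf f ->
  `|dot (grad f z) (row_mx 0 eta)| <= Cf * enorm eta.
Proof.
move=> df fC; have := is_derive_line_fun z (row_mx 0 eta) 0 df.
rewrite scale0r addr0 => d; apply: (derive_lipschitz_le d) => t.
rewrite scale0r add0r addr0 -{1 2}[z]hsubmxK -row_mx0_scale -row_mx_shift.
apply: le_trans (fC _ _ _) _.
by rewrite [_ + t *: _]addrC addrK enormZ -mulrA (mulrC (enorm eta)).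
Qed.

End LowerLevel.

(** * The lower-level problems of [g] and of the penalty *)

Section Instances.
Context (R : realType) (dx dy : nat) (f g : 'rV[R]_(dx + dy) -> R).
Context (mu Cf Lf Lg rhof rhog lam : R).
Hypothesis dy_gt0 : (0 < dy)%N.
Hypothesis mu_gt0 : 0 < mu.
Hypothesis lam_gt0 : 0 < lam.
Hypothesis lam_ge : 2 * Lf / mu <= lam.
Hypothesis g_convex : forall x : 'rV[R]_dx,
  strongly_convex mu (fun y : 'rV[R]_dy => g (row_mx x y)).
Hypothesis g_grad : lipschitz_grad Lg g.
Hypothesis g_hess : lipschitz_hess rhog g.
Hypothesis f_lip : lipschitz_in_y Cf f.
Hypothesis f_grad : lipschitz_grad Lf f.
Hypothesis f_hess : lipschitz_hess rhof f.

Let dim_gt0 : (0 < dx + dy)%N. Proof. by rewrite addn_gt0 dy_gt0 orbT. Qed.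

Lemma lipschitz_grad_ge0 L h : lipschitz_grad L (h : 'rV[R]_(dx + dy) -> R) -> 0 <= L.
Proof. by case=> _ /lipschitz_cst_ge0; apply=> // z z'; exact: enorm_ge0. Qed.

Lemma lipschitz_hess_ge0 L h : lipschitz_hess L (h : 'rV[R]_(dx + dy) -> R) -> 0 <= L.
Proof. by case=> _ /lipschitz_cst_ge0; apply=> // z z'; exact: opnorm_ge0. Qed.

Let Lg0 := lipschitz_grad_ge0 g_grad.
Let Lf0 := lipschitz_grad_ge0 f_grad.
Let rg0 := lipschitz_hess_ge0 g_hess.
Let rf0 := lipschitz_hess_ge0 f_hess.

(** The curvature of [f] cancels at most half of the modulus [lam * mu], which leaves [lam * mu / 2]
    for the penalty. *)
Let Lf_le : Lf <= lam * mu / 2.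
Proof. by move: lam_ge; rewrite ler_pdivrMr //; lra. Qed.

Lemma ystar_min x y' : g (row_mx x (ystar g x)) <= g (row_mx x y').
Proof.
apply: (@coercive_argminP _ _ (fun y => g (row_mx x y))
         (enorm (grad g (row_mx x 0))) (mu / 2)).
- by rewrite divr_gt0.
- exact: continuous_partial g_grad.1.
- move=> y; have := strongly_convex_first_order y 0 Lg0 g_grad (g_convex x).
  have := normr_dot_le (grad g (row_mx x 0)) (row_mx 0 y).
  by rewrite enorm_row_mx0 !subr0 ler_norml => /andP[h1 _]; lra.
Qed.

Lemma ystar_inner_problem : inner_problem (grad g) (hess g) (ystar g) Lg mu rhog.
Proof.
split=> //.
- by move=> z z'; exact: g_grad.2.
- by move=> z w q; exact: taylor2.
- by move=> z p q; exact: hess_bounded g_hess.1 g_grad.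
- by move=> z p q; exact: hess_sym g_hess.
- by move=> x y y'; exact: (strongly_convex_monotone y y' Lg0 g_grad (g_convex x)).
- move=> x; apply: (@minimizer_critical _ _ _ g) (ystar_min x) => w.
  exact: (taylor1 _ _ Lg0 g_grad).
Qed.

(** [f] falls at most linearly in [y], at rate [Cf], while [lam * g] grows quadratically. *)
Lemma ystar_pen_min x y' :
  penalty f g lam x (ystar_pen f g lam x) <= penalty f g lam x y'.
Proof.
apply: (@coercive_argminP _ _ (penalty f g lam x)
         (Cf + lam * enorm (grad g (row_mx x 0))) (lam * (mu / 2))).
- by rewrite mulr_gt0 // divr_gt0.
- have cf : continuous (fun y => f (row_mx x y)) by exact: continuous_partial f_grad.1.
  have cg : continuous (fun y => g (row_mx x y)) by exact: continuous_partial g_grad.1.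
  move=> y; apply: (@continuousD _ _ _ (fun y => f (row_mx x y))
                      (fun y => lam * (g (row_mx x y) - gstar g x))); first exact: cf.
  apply: continuousM; first exact: cst_continuous.
  by apply: continuousB; [exact: cg|exact: cst_continuous].
- move=> y; rewrite /penalty.
  have := strongly_convex_first_order y 0 Lg0 g_grad (g_convex x).
  have := normr_dot_le (grad g (row_mx x 0)) (row_mx 0 y).
  rewrite enorm_row_mx0 !subr0 ler_norml => /andP[h1 _] h2.
  have := f_lip x y 0; rewrite subr0 ler_norml => /andP[h3 _].
  have : lam * (g (row_mx x 0) - enorm (grad g (row_mx x 0)) * enorm y
     + mu / 2 * enorm y ^+ 2) <= lam * g (row_mx x y) by rewrite ler_pM2l //; lra.
  lra.
Qed.

(** The term [gstar] is left out: it depends on [x] alone and is treated as a second envelope. *)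
Definition pen_grad z : 'rV[R]_(dx + dy) := grad f z + lam *: grad g z.
Definition pen_hess z : 'M[R]_(dx + dy) := hess f z + lam *: hess g z.

Lemma dot_pen_grad z w : dot (pen_grad z) w = dot (grad f z) w + lam * dot (grad g z) w.
Proof. by rewrite dotDl dotZl. Qed.

Lemma dot_pen_hess z p q :
  dot (p *m pen_hess z) q = dot (p *m hess f z) q + lam * dot (p *m hess g z) q.
Proof. by rewrite mulmxDr -scalemxAr dotDl dotZl. Qed.

Lemma pen_taylor1 z w :
  `|(f (z + w) + lam * g (z + w)) - (f z + lam * g z) - dot (pen_grad z) w|
    <= (Lf + lam * Lg) * enorm w ^+ 2.
Proof.
have h1 := taylor1 z w Lf0 f_grad; have h2 := taylor1 z w Lg0 g_grad.
have -> : f (z + w) + lam * g (z + w) - (f z + lam * g z) - dot (pen_grad z) w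
  = (f (z + w) - f z - dot (grad f z) w)
    + lam * (g (z + w) - g z - dot (grad g z) w) by rewrite dot_pen_grad; ring.
apply: le_trans (ler_normD _ _) _; rewrite normrM (gtr0_norm lam_gt0) mulrDl -mulrA.
by rewrite lerD // ler_pM2l.
Qed.

Lemma ystar_pen_inner_problem : inner_problem pen_grad pen_hess (ystar_pen f g lam)
  (Lf + lam * Lg) (lam * mu / 2) (rhof + lam * rhog).
Proof.
split.
- by rewrite divr_gt0 // mulr_gt0.
- by rewrite addr_ge0 // mulr_ge0 // ltW.
- by rewrite addr_ge0 // mulr_ge0 // ltW.
- move=> z z'; rewrite /pen_grad opprD addrACA -scalerBr mulrDl -mulrA.
  apply: le_trans (enormD _ _) _; rewrite enormZ (gtr0_norm lam_gt0).
  by rewrite lerD ?f_grad.2 // ler_pM2l // g_grad.2.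
- move=> z w q.
  have -> : dot (pen_grad (z + w) - pen_grad z - w *m pen_hess z) q
    = dot (grad f (z + w) - grad f z - w *m hess f z) q
      + lam * dot (grad g (z + w) - grad g z - w *m hess g z) q.
    have gen (a a' b b' : 'rV[R]_(dx + dy)) (A A' : 'M[R]_(dx + dy)) :
        dot (a + lam *: a' - (b + lam *: b') - w *m (A + lam *: A')) q
        = dot (a - b - w *m A) q + lam * dot (a' - b' - w *m A') q.
      by rewrite mulmxDr -scalemxAr !dotBl !dotDl !dotZl; ring.
    exact: gen.
  apply: le_trans (ler_normD _ _) _; rewrite normrM (gtr0_norm lam_gt0).
  rewrite !mulrDl -(mulrA lam) -(mulrA lam).
  by rewrite lerD ?ler_pM2l //; exact: taylor2.
- move=> z p q; rewrite dot_pen_hess.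
  apply: le_trans (ler_normD _ _) _; rewrite normrM (gtr0_norm lam_gt0).
  rewrite !mulrDl -(mulrA lam) -(mulrA lam) lerD ?ler_pM2l //.
    exact: hess_bounded f_hess.1 f_grad.
  exact: hess_bounded g_hess.1 g_grad.
- move=> z p q; rewrite !dot_pen_hess.
  congr (_ + lam * _); first exact: (hess_sym z p q rf0 f_hess).
  exact: (hess_sym z p q rg0 g_hess).
- move=> x y y'; rewrite dotBl !dot_pen_grad.
  have := strongly_convex_monotone y y' Lg0 g_grad (g_convex x).
  rewrite -(ler_pM2l lam_gt0) dotBl => h1.
  have := normr_dot_le (grad f (row_mx x y) - grad f (row_mx x y')) (row_mx 0 (y - y')).
  have := f_grad.2 (row_mx x y) (row_mx x y').
  rewrite row_mx_sub enorm_row_mx0 dotBl => h2.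
  move=> /le_trans/(_ (ler_wpM2r (enorm_ge0 _) h2)).
  rewrite ler_norml => /andP[h3 _].
  have := ler_wpM2r (sqr_ge0 (enorm (y - y'))) Lf_le; lra.
- move=> x; apply: (@minimizer_critical _ _ _ (fun z => f z + lam * g z)).
    by move=> w; exact: pen_taylor1.
  by move=> y'; have := ystar_pen_min x y'; rewrite /penalty; lra.
Qed.

End Instances.

(** * Constants *)

(** In these variables [D5] is linear in [rhof], [a], [X], [Y], with polynomial coefficients in
    [k]. *)
Lemma D5E (R : realType) (mu Cf Lf Lg rhof rhog nug : R) : 0 < mu ->
  let k := Lg / mu in let X := rhog * Lf / mu in
  let Y := Cf * rhog ^+ 2 / mu ^+ 2 in let a := Cf * nug / mu in
  D5 mu Cf Lf Lg rhof rhog nug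
  = (3 * (1 + 4 * k) ^+ 2 + 50 * k ^+ 3) * rhof
    + ((1 + k) ^+ 2 + 50 * k ^+ 3) * a
    + 2 * (1 + 4 * k) ^+ 2 * X + (1 + k) ^+ 2 * Y
    + ((2 + 5 * k + 14 * k ^+ 2) * (1 + 2 * k) + 2 * k * (1 + k) ^+ 2) * (X + Y).
Proof. by move=> mu0 /=; rewrite /D5 /D4 /D2; field; rewrite gt_eqF. Qed.

Section Constants.
Context (R : realType) (mu Cf Lf Lg rhof rhog nug : R).
Hypothesis mu_gt0 : 0 < mu.
Hypothesis mu_le_Lg : mu <= Lg.
Hypothesis Cf_ge0 : 0 <= Cf.
Hypothesis Lf_ge0 : 0 <= Lf.
Hypothesis rhof_ge0 : 0 <= rhof.
Hypothesis rhog_ge0 : 0 <= rhog.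
Hypothesis nug_ge0 : 0 <= nug.

Let muV_ge0 : 0 <= mu^-1. Proof. by rewrite invr_ge0 ltW. Qed.
Let k_ge1 : 0 <= Lg / mu - 1.
Proof. by rewrite subr_ge0 ler_pdivlMr // mul1r. Qed.
Let X_ge0 : 0 <= rhog * Lf / mu. Proof. by rewrite !mulr_ge0. Qed.
Let Y_ge0 : 0 <= Cf * rhog ^+ 2 / mu ^+ 2.
Proof. by rewrite divr_ge0 ?sqr_ge0 // mulr_ge0 ?sqr_ge0. Qed.
Let a_ge0 : 0 <= Cf * nug / mu. Proof. by rewrite !mulr_ge0. Qed.

(** The left side is what the estimate of the Hessian increment produces. [S] and [S0] enter through
    equations so that local definitions can be supplied with [erefl]. *)
Lemma D5_ge (S S0 : R) : S = 2 * (Lg / mu) + 3 / 2 -> S0 = Lg / mu + 1 / 2 ->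
  rhof * S ^+ 3 + nug * S ^+ 3 * (Cf / mu)
    + rhog * D2 mu Cf Lf Lg rhog * (S ^+ 2 + S * S0 + S0 ^+ 2)
  <= D5 mu Cf Lf Lg rhof rhog nug.
Proof.
move=> -> ->; rewrite D5E //=.
have -> : rhog * D2 mu Cf Lf Lg rhog
    = (1 + 2 * (Lg / mu)) * (rhog * Lf / mu + Cf * rhog ^+ 2 / mu ^+ 2).
  by rewrite /D2; field; rewrite gt_eqF.
have -> : forall s, nug * s * (Cf / mu) = Cf * nug / mu * s by move=> s; ring.
move: k_ge1 X_ge0 Y_ge0 a_ge0.
move: (rhog * Lf / mu) (Cf * rhog ^+ 2 / mu ^+ 2) (Cf * nug / mu) => X Y a.
have -> : Lg / mu = 1 + (Lg / mu - 1) by rewrite addrC subrK.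
move: (Lg / mu - 1) => t; rewrite addrAC subrr add0r => t0 X0 Y0 a0.
rewrite -subr_ge0; set d := (X in 0 <= X).
(* Part of the [X] term is moved so that [X] and [Y] share a bracket. With [t = k - 1] every bracket
   has nonnegative coefficients in powers of [t]. *)
have -> : d = rhof * (3 * (1 + 4 * (1 + t)) ^+ 2 + 50 * (1 + t) ^+ 3
                      - (2 * (1 + t) + 3 / 2) ^+ 3)
  + a * ((1 + (1 + t)) ^+ 2 + 50 * (1 + t) ^+ 3 - (2 * (1 + t) + 3 / 2) ^+ 3)
  + X * (2 * (1 + 4 * (1 + t)) ^+ 2 - (1 + (1 + t)) ^+ 2)
  + (X + Y) * ((1 + (1 + t)) ^+ 2 + 2 * (1 + t) * (1 + (1 + t)) ^+ 2
     + (1 + 2 * (1 + t)) * (2 + 5 * (1 + t) + 14 * (1 + t) ^+ 2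
        - ((2 * (1 + t) + 3 / 2) ^+ 2 + (2 * (1 + t) + 3 / 2) * (1 + t + 1 / 2)
           + (1 + t + 1 / 2) ^+ 2))).
  by rewrite /d; field.
have t2 : 0 <= t ^+ 2 by rewrite exprn_ge0.
have t3 : 0 <= t ^+ 3 by rewrite exprn_ge0.
apply: addr_ge0; [apply: addr_ge0; [apply: addr_ge0|]|];
  apply: mulr_ge0 => //; lra.
Qed.

Lemma D5_ge0 : 0 <= D5 mu Cf Lf Lg rhof rhog nug.
Proof.
rewrite D5E //=; move: k_ge1 X_ge0 Y_ge0 a_ge0.
move: (Lg / mu) (rhog * Lf / mu) (Cf * rhog ^+ 2 / mu ^+ 2) (Cf * nug / mu).
move=> k X Y a k1 X0 Y0 a0; have k0 : 0 <= k by lra.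
have k2 : 0 <= k ^+ 2 by rewrite exprn_ge0.
have k3 : 0 <= k ^+ 3 by rewrite exprn_ge0.
apply: addr_ge0; [apply: addr_ge0; [apply: addr_ge0; [apply: addr_ge0|]|]|];
  apply: mulr_ge0 => //; lra.
Qed.

Lemma D5_le : D5 mu Cf Lf Lg rhof rhog nug <=
  375 * ell Cf Lf Lg rhof rhog nug * kappa mu Cf Lf Lg rhof rhog nug ^+ 5.
Proof.
rewrite D5E //= /kappa; set l := ell _ _ _ _ _ _.
have : [/\ Cf <= l, Lf <= l & Lg <= l] /\ [/\ rhog <= l, rhof <= l & nug <= l].
  by rewrite /l /ell; split; split; rewrite !le_max lexx ?orbT.
move: l => l [[Cl Ll Lgl] [rgl rfl nl]].
have l0 : 0 <= l by apply: le_trans Cl.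
have kl : Lg / mu <= l / mu by rewrite ler_wpM2r.
set K := l / mu in kl *.
have K1 : 1 <= K by apply: le_trans kl; rewrite -subr_ge0.
have K0 : 0 <= K by apply: le_trans K1.
have lK : l <= l * K by rewrite ler_peMr.
have lKK : l * K <= l * K ^+ 2 by rewrite ler_wpM2l // expr2 ler_peMr.
have rB : rhof <= l * K ^+ 2 by rewrite (le_trans rfl) // (le_trans lK).
have XB : rhog * Lf / mu <= l * K ^+ 2.
  by apply: le_trans lKK; rewrite /K mulrA ler_wpM2r // ler_pM.
have aB : Cf * nug / mu <= l * K ^+ 2.
  by apply: le_trans lKK; rewrite /K mulrA ler_wpM2r // ler_pM.
have YB : Cf * rhog ^+ 2 / mu ^+ 2 <= l * K ^+ 2.
  rewrite /K expr_div_n [leRHS]mulrA ler_wpM2r ?invr_ge0 ?sqr_ge0 // ler_pM ?sqr_ge0 //.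
  by rewrite lerXn2r ?nnegrE.
move: k_ge1 X_ge0 Y_ge0 a_ge0 kl XB YB aB rB.
(* [l * K ^+ 2] bounds each of [rhof], [a], [X], [Y], and [K ^+ 3] is left for the cubic
   coefficients. *)
have -> : 375 * l * K ^+ 5 = 375 * K ^+ 3 * (l * K ^+ 2) by ring.
move: (l * K ^+ 2) (Lg / mu) (rhog * Lf / mu) (Cf * rhog ^+ 2 / mu ^+ 2) (Cf * nug / mu).
move=> B k X Y a; rewrite subr_ge0 => k1 X0 Y0 a0 kK XB YB aB rB.
have k0 : 0 <= k by apply: le_trans k1.
have B0 : 0 <= B by apply: le_trans X0 XB.
have k2 : 0 <= k ^+ 2 by rewrite exprn_ge0.
have k3 : 0 <= k ^+ 3 by rewrite exprn_ge0.
apply: (@le_trans _ _ ((3 * (1 + 4 * k) ^+ 2 + 50 * k ^+ 3) * B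
    + ((1 + k) ^+ 2 + 50 * k ^+ 3) * B + 2 * (1 + 4 * k) ^+ 2 * B + (1 + k) ^+ 2 * B
    + ((2 + 5 * k + 14 * k ^+ 2) * (1 + 2 * k) + 2 * k * (1 + k) ^+ 2) * (B + B))).
  apply: lerD; [apply: lerD; [apply: lerD; [apply: lerD|]|]|];
    by apply: ler_wpM2l; [lra|rewrite ?lerD].
rewrite mulrDr -!mulrDl ler_wpM2r //.
have kk : k <= k ^+ 2 by rewrite expr2 ler_peMr.
have kk3 : k ^+ 2 <= k ^+ 3 by rewrite [leRHS]exprS ler_peMl.
(* As [k >= 1], every power is at most [k ^+ 3]; 375 is the value of the whole coefficient at
   [k = 1]. *)
apply: (@le_trans _ _ (375 * k ^+ 3)); first by lra.
by rewrite ler_pM2l // lerXn2r ?nnegrE.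
Qed.

End Constants.

(** * The penalty function *)

Section Penalty.
Context (R : realType) (dx dy : nat) (f g : 'rV[R]_(dx + dy) -> R).
Context (mu Cf Lf Lg rhof rhog nug lam : R).
Hypothesis dy_gt0 : (0 < dy)%N.
Hypothesis mu_gt0 : 0 < mu.
Hypothesis lam_gt0 : 0 < lam.
Hypothesis lam_ge : 2 * Lf / mu <= lam.
Hypothesis g_convex : forall x : 'rV[R]_dx,
  strongly_convex mu (fun y : 'rV[R]_dy => g (row_mx x y)).
Hypothesis g_grad : lipschitz_grad Lg g.
Hypothesis g_hess : lipschitz_hess rhog g.
Hypothesis g_third : lipschitz_third nug g.
Hypothesis f_lip : lipschitz_in_y Cf f.
Hypothesis f_grad : lipschitz_grad Lf f.
Hypothesis f_hess : lipschitz_hess rhof f.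
Implicit Types (x k v u : 'rV[R]_dx) (p q : 'rV[R]_(dx + dy)).

Local Notation y0 := (ystar g).
Local Notation yl := (ystar_pen f g lam).
Local Notation J0 := (inner_jacobian (hess g) y0).
Local Notation Jl := (inner_jacobian (pen_hess f g lam) yl).
Local Notation T0 := (tangent (hess g) y0).
Local Notation Tl := (tangent (pen_hess f g lam) yl).
Local Notation z0 := (graph_at y0).
Local Notation zl := (graph_at yl).

Let inner0 : inner_problem (grad g) (hess g) y0 Lg mu rhog :=
  ystar_inner_problem dy_gt0 mu_gt0 g_convex g_grad g_hess.
Let innerl : inner_problem (pen_grad f g lam) (pen_hess f g lam) yl
    (Lf + lam * Lg) (lam * mu / 2) (rhof + lam * rhog) :=
  ystar_pen_inner_problem dy_gt0 mu_gt0 lam_gt0 lam_ge g_convex g_grad g_hess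
    f_lip f_grad f_hess.

Let Lg0 : 0 <= Lg := lipschitz_grad_ge0 dy_gt0 g_grad.
Let Lf0 : 0 <= Lf := lipschitz_grad_ge0 dy_gt0 f_grad.
Let rg0 : 0 <= rhog := lipschitz_hess_ge0 dy_gt0 g_hess.
Let rf0 : 0 <= rhof := lipschitz_hess_ge0 dy_gt0 f_hess.

Lemma in_y_cst_ge0 : 0 <= Cf.
Proof.
apply: (@lipschitz_cst_ge0 _ _ (fun y y' => `|f (row_mx 0 y) - f (row_mx 0 y')|)
          _ dy_gt0) => // y y'; exact: f_lip.
Qed.

(** The energy of a nonzero vertical vector is at least [mu] and at most [Lg] times its squared
    norm. *)
Lemma strong_convexity_le : mu <= Lg.
Proof.
have [m0 _ _ _ _ Hb _ _ _] := inner0.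
have [e e0] := exists_enorm_gt0 R dy_gt0.
have := H_coercive inner0 0 e.
move=> /le_trans/(_ (le_trans (ler_norm _) (Hb 0 _ _))).
by rewrite enorm_row_mx0 -mulrA -expr2 ler_pM2r // exprn_gt0.
Qed.

Let Cf0 := in_y_cst_ge0.
Let nu0 : 0 <= nug.
Proof. by apply: lipschitz_third_ge0 g_third; rewrite addn_gt0 dy_gt0 orbT. Qed.
Let muL := strong_convexity_le.

Let kap_ge1 : 1 <= Lg / mu.
Proof. by rewrite ler_pdivlMr // mul1r. Qed.

(** For [k = Lg / mu >= 1], [S] and [S0] dominate the roots of [1 + (1 + 2 k)^2] and [1 + k^2], the
    norms of tangents whose vertical slopes are at most [1 + 2 k] and [k]. *)
Let S := 2 * (Lg / mu) + 3 / 2.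
Let S0 := Lg / mu + 1 / 2.
Let E := D2 mu Cf Lf Lg rhog.

Let S_ge0 : 0 <= S. Proof. by rewrite /S; move: kap_ge1; lra. Qed.
Let S0_ge0 : 0 <= S0. Proof. by rewrite /S0; move: kap_ge1; lra. Qed.
Let S0_le : S0 <= S. Proof. by rewrite /S0 /S; move: kap_ge1; lra. Qed.
Let E_ge0 : 0 <= E.
Proof. by rewrite /E /D2 mulr_ge0 ?addr_ge0 ?divr_ge0 ?mulr_ge0 ?exprn_ge0 // ltW. Qed.

(** Slopes of the penalized minimizer are thus bounded independently of [lam]. *)
Let pen_ratio : (Lf + lam * Lg) / (lam * mu / 2) <= 1 + 2 * (Lg / mu).
Proof.
rewrite ler_pdivrMr ?divr_gt0 ?mulr_gt0 //.
have -> : (1 + 2 * (Lg / mu)) * (lam * mu / 2) = lam * mu / 2 + lam * Lg.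
  by field; rewrite gt_eqF.
by rewrite lerD2r; move: lam_ge; rewrite ler_pdivrMr //; move: lam_gt0; lra.
Qed.

Let sqS : 1 + (1 + 2 * (Lg / mu)) ^+ 2 <= S ^+ 2.
Proof. by rewrite /S; move: kap_ge1; nra. Qed.
Let sqS0 : 1 + (Lg / mu) ^+ 2 <= S0 ^+ 2.
Proof. by rewrite /S0; move: kap_ge1; nra. Qed.

(** * Graphs, tangents and the gap between the two minimizers *)

Lemma tangent0_bounded x v : enorm (v *m T0 x) <= S0 * enorm v.
Proof.
rewrite mul_tangent; apply: (enorm_row_mx_bound _ _ sqS0) => //; first by move: kap_ge1; lra.
exact: (inner_jacobian_bounded inner0).
Qed.

Lemma tangent_pen_bounded x v : enorm (v *m Tl x) <= S * enorm v.
Proof.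
rewrite mul_tangent; apply: (enorm_row_mx_bound _ _ sqS) => //; first by move: kap_ge1; lra.
apply: le_trans (inner_jacobian_bounded innerl _ _) _.
by rewrite ler_wpM2r ?enorm_ge0.
Qed.

Lemma graph0_lipschitz x x' : enorm (z0 x' - z0 x) <= S0 * enorm (x' - x).
Proof.
rewrite graph_at_sub; apply: (enorm_row_mx_bound _ _ sqS0) => //; first by move: kap_ge1; lra.
exact: (inner_lipschitz inner0).
Qed.

Lemma graph_pen_lipschitz x x' : enorm (zl x' - zl x) <= S * enorm (x' - x).
Proof.
rewrite graph_at_sub; apply: (enorm_row_mx_bound _ _ sqS) => //; first by move: kap_ge1; lra.
apply: le_trans (inner_lipschitz innerl _ _) _.
by rewrite ler_wpM2r ?enorm_ge0.
Qed.

(* [mu |yl - y0|^2 <= <grad_y g (x, yl), yl - y0> = - lam^-1 <grad_y f, yl - y0>] *)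
Lemma minimizer_gap x : enorm (zl x - z0 x) <= Cf / (lam * mu).
Proof.
rewrite /graph_at row_mx_sub enorm_row_mx0.
apply: enorm_le_of_coercive => //; first exact: mulr_gt0.
set e := yl x - y0 x.
have h1 := inner_G_monotone inner0 x (yl x) (y0 x).
rewrite dotBl (inner_critical inner0) subr0 -/e in h1.
have h2 := inner_critical innerl x e; rewrite dot_pen_grad in h2.
have := vertical_grad_bounded (row_mx x (yl x)) e f_grad.1 f_lip.
rewrite ler_norml => /andP[h3 _].
rewrite -(ler_pM2l lam_gt0) in h1; lra.
Qed.

(** Test the penalized Hessian on the vertical difference of the two tangents. Orthogonality removes
    [v *m Tl x] and turns the [g] part into a Hessian difference between [zl x] and [z0 x]. The gap
    [Cf / (lam * mu)] cancels [lam] there, while coercivity still contributes [1 / lam]. *)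
Lemma inner_jacobian_gap x v : enorm (v *m Jl x - v *m J0 x) <= E / lam * enorm v.
Proof.
(* Here [2 * S0 / mu] is exactly the first factor of [D2], which explains the choice of [S0]. *)
have -> : E / lam * enorm v
    = (Lf + rhog * (Cf / (lam * mu)) * lam) * S0 * enorm v / (lam * mu / 2).
  rewrite /E /D2 /S0; field; rewrite !gt_eqF //.
set e := v *m Jl x - v *m J0 x.
have c0 : 0 <= Lf + rhog * (Cf / (lam * mu)) * lam.
  by rewrite addr_ge0 // !mulr_ge0 ?invr_ge0 ?mulr_ge0 // ltW.
apply: enorm_le_of_coercive; rewrite ?(inner_m_gt0 innerl) ?mulr_ge0 ?enorm_ge0 //.
have TT : v *m Tl x - v *m T0 x = row_mx 0 e.
  by rewrite !mul_tangent row_mx_sub.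
apply: le_trans (H_coercive innerl (zl x) e) _.
have -> : dot (row_mx 0 e *m pen_hess f g lam (zl x)) (row_mx 0 e)
   = - (dot (v *m T0 x *m hess f (zl x)) (row_mx 0 e)
        + lam * dot (v *m T0 x *m (hess g (zl x) - hess g (z0 x))) (row_mx 0 e)).
  rewrite -{1}TT mulmxBl dotBl (tangent_orthogonal innerl) sub0r; congr (- _).
  have split_pen (A B B' : 'M[R]_(dx + dy)) p q : dot (p *m B') q = 0 ->
      dot (p *m (A + lam *: B)) q = dot (p *m A) q + lam * dot (p *m (B - B')) q.
    by move=> pB'; rewrite mulmxDr -scalemxAr dotDl dotZl dot_mulmxBr pB' subr0.
  exact: split_pen (tangent_orthogonal inner0 x v e).
apply: le_trans (ler_norm _) _; rewrite normrN.
apply: le_trans (ler_normD _ _) _; rewrite normrM (gtr0_norm lam_gt0).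
have h1 := hess_bounded (zl x) (v *m T0 x) (row_mx 0 e) f_hess.1 f_grad.
have h2 := hess_lipschitz (zl x) (z0 x) (v *m T0 x) (row_mx 0 e) g_hess.
rewrite enorm_row_mx0 in h1 h2.
have h3 := tangent0_bounded x v; have h4 := minimizer_gap x.
have e0 := enorm_ge0 e.
apply: (@le_trans _ _ (Lf * (S0 * enorm v) * enorm e
   + lam * (rhog * (Cf / (lam * mu)) * (S0 * enorm v) * enorm e))); last first.
  by rewrite le_eqVlt; apply/orP; left; apply/eqP; ring.
apply: lerD.
  by apply: le_trans h1 _; rewrite ler_wpM2r // ler_wpM2l.
rewrite ler_pM2l //; apply: le_trans h2 _; rewrite ler_wpM2r //.
by rewrite ler_pM ?mulr_ge0 ?enorm_ge0 // ler_wpM2l.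
Qed.

(** The mean value theorem along the segment from [x'] to [x] integrates the bound of
    [inner_jacobian_gap]. *)
Lemma minimizer_gap_lipschitz x x' :
  enorm (zl x - zl x' - (z0 x - z0 x')) <= E / lam * enorm (x - x').
Proof.
rewrite !graph_at_sub row_mx_sub enorm_row_mx0; set k := x - x'.
have c0 : 0 <= E / lam * enorm k by rewrite mulr_ge0 ?enorm_ge0 // divr_ge0 // ltW.
apply: enorm_dual_le => // q.
pose phi (s : R) := dot (yl (x' + s *: k) - y0 (x' + s *: k)) q.
pose dphi (s : R) := dot (k *m Jl (x' + s *: k) - k *m J0 (x' + s *: k)) q.
have -> : dot (yl x - yl x' - (y0 x - y0 x')) q = phi 1 - phi 0.
  by rewrite /phi scale1r scale0r addr0 subrKC !dotBl; ring.
apply: le_trans (ler_norm _) _; apply: (@MVT_le _ _ dphi) => [s|s _]; last first.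
  apply: le_trans (normr_dot_le _ _) _.
  by rewrite ler_wpM2r ?enorm_ge0 // inner_jacobian_gap.
(* Differentiability along the segment needs only some quadratic constant. *)
have [Cl HCl] : exists C, forall x k,
    enorm (yl (x + k) - yl x - k *m Jl x) <= C * enorm k ^+ 2.
  by eexists; exact: (inner_taylor innerl).
have [C0 HC0] : exists C, forall x k,
    enorm (y0 (x + k) - y0 x - k *m J0 x) <= C * enorm k ^+ 2.
  by eexists; exact: (inner_taylor inner0).
apply: (@is_derive_of_remainder _ _ _ _ ((Cl + C0) * enorm k ^+ 2 * enorm q)) => t.
set x1 := x' + s *: k.
have -> : phi (s + t) - phi s - t * dphi s
  = dot (yl (x1 + t *: k) - yl x1 - (t *: k) *m Jl x1) q
    - dot (y0 (x1 + t *: k) - y0 x1 - (t *: k) *m J0 x1) q.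
  have regroup (a b a' b' j j' : 'rV[R]_dy) :
      dot (a - b) q - dot (a' - b') q - t * dot (j - j') q
      = dot (a - a' - t *: j) q - dot (b - b' - t *: j') q.
    by rewrite !dotBl !dotZl; ring.
  rewrite /phi /dphi scalerDl addrA -/x1 -!scalemxAl; exact: regroup.
apply: le_trans (ler_normB _ _) _.
have := le_trans (normr_dot_le _ q) (ler_wpM2r (enorm_ge0 q) (HCl x1 (t *: k))).
have := le_trans (normr_dot_le _ q) (ler_wpM2r (enorm_ge0 q) (HC0 x1 (t *: k))).
rewrite !enormZ !exprMn !real_normK ?num_real //; lra.
Qed.

(** * Gradient and Hessian of the penalty function as differences of two envelopes *)

Lemma penalty_star_grad x :
  differentiable (penalty_star f g lam) x /\
  grad (penalty_star f g lam) x
    = lsubmx (pen_grad f g lam (zl x)) - lam *: lsubmx (grad g (z0 x)).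
Proof.
pose Cl := (Lf + lam * Lg) * (1 + (Lf + lam * Lg) / (lam * mu / 2)) ^+ 2.
pose C0 := Lg * (1 + Lg / mu) ^+ 2.
apply: (@grad_of_remainder _ _ _ _ _ (Cl + lam * C0)) => k.
have hl := envelope_taylor innerl (h := fun z => f z + lam * g z) x k
  (pen_taylor1 dy_gt0 lam_gt0 g_grad f_grad).
have h0 := envelope_taylor inner0 x k (fun z w => taylor1 z w Lg0 g_grad).
rewrite /penalty_star /penalty /gstar -!/(graph_at _ _) dotBl dotZl.
move: hl h0; rewrite -/Cl -/C0; set dl := dot _ _; set d0 := dot _ _.
move: (f (zl (x + k))) (f (zl x)) (g (zl (x + k))) (g (zl x)) (g (z0 (x + k)))
  (g (z0 x)) => a a' b b' c c' hl h0.
have -> : a + lam * (b - c) - (a' + lam * (b' - c')) - (dl - lam * d0)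
  = (a + lam * b - (a' + lam * b') - dl) - lam * (c - c' - d0) by ring.
apply: le_trans (ler_normB _ _) _; rewrite normrM (gtr0_norm lam_gt0) mulrDl -mulrA.
by rewrite lerD // ler_pM2l.
Qed.

Lemma penalty_star_hess x :
  differentiable (grad (penalty_star f g lam)) x /\
  hess (penalty_star f g lam) x
    = envelope_hess (pen_hess f g lam) yl x - lam *: envelope_hess (hess g) y0 x.
Proof.
have [Cl HCl] : exists C, forall k,
    enorm (lsubmx (pen_grad f g lam (zl (x + k))) - lsubmx (pen_grad f g lam (zl x))
           - k *m envelope_hess (pen_hess f g lam) yl x) <= C * enorm k ^+ 2.
  by eexists; exact: (envelope_grad_taylor innerl).
have [C0 HC0] : exists C, forall k,
    enorm (lsubmx (grad g (z0 (x + k))) - lsubmx (grad g (z0 x))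
           - k *m envelope_hess (hess g) y0 x) <= C * enorm k ^+ 2.
  by eexists; exact: (envelope_grad_taylor inner0).
apply: (@jacobian_of_remainder _ _ _ _ _ _ (Cl + lam * C0)) => k.
have regroup (a a' b b' : 'rV[R]_dx) (A B : 'M[R]_dx) :
    a - lam *: b - (a' - lam *: b') - k *m (A - lam *: B)
    = (a - a' - k *m A) - lam *: (b - b' - k *m B).
  rewrite mulmxBr -scalemxAr; move: (k *m A) (k *m B) => c d.
  by apply/rowP => i; rewrite !mxE; ring.
rewrite !(penalty_star_grad _).2 regroup.
apply: le_trans (enormD _ _) _; rewrite enormN enormZ (gtr0_norm lam_gt0) mulrDl -mulrA.
by rewrite lerD // ler_pM2l.
Qed.

(** Apply [envelope_hess_sub] to both envelopes, then exchange one factor at a time: the Hessian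
    increment of [g], the left tangent, the right tangent. Each term multiplied by [lam] then
    contains one difference of order [1 / lam]. *)
Lemma penalty_star_hess_sub x x' v u :
  dot (v *m (hess (penalty_star f g lam) x - hess (penalty_star f g lam) x')) u
  = dot (v *m Tl x *m (hess f (zl x) - hess f (zl x'))) (u *m Tl x')
    + lam * (dot (v *m Tl x *m (hess g (zl x) - hess g (zl x')
                                - (hess g (z0 x) - hess g (z0 x')))) (u *m Tl x')
             + dot ((v *m Tl x - v *m T0 x) *m (hess g (z0 x) - hess g (z0 x')))
                   (u *m Tl x')
             + dot (v *m T0 x *m (hess g (z0 x) - hess g (z0 x')))
                   (u *m Tl x' - u *m T0 x')).
Proof.
have regroup (A B C D : 'M[R]_dx) :
    dot (v *m (A - lam *: B - (C - lam *: D))) u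
    = dot (v *m (A - C)) u - lam * dot (v *m (B - D)) u.
  by rewrite !dot_mulmxBr -!scalemxAr !dotZl; ring.
rewrite !(penalty_star_hess _).2 regroup.
rewrite (envelope_hess_sub innerl) (envelope_hess_sub inner0).
rewrite /pen_hess; move: (hess f (zl x)) (hess f (zl x')) (hess g (zl x)) (hess g (zl x'))
  (hess g (z0 x)) (hess g (z0 x')).
move: (v *m Tl x) (v *m T0 x) (u *m Tl x') (u *m T0 x') => p p' q q' A A' B B' D D'.
have -> : A + lam *: B - (A' + lam *: B') = (A - A') + lam *: (B - B').
  by rewrite opprD addrACA -scalerBr.
rewrite mulmxDr dotDl -scalemxAr dotZl !mulmxBl !dotBl !dotBr !dot_mulmxBr.
ring.
Qed.

Lemma penalty_star_hess_lipschitz :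
  lipschitz_hess (D5 mu Cf Lf Lg rhof rhog nug) (penalty_star f g lam).
Proof.
split; first by split=> x; [exact: (penalty_star_grad x).1|exact: (penalty_star_hess x).1].
move=> x x'; set e := enorm (x - x').
have e0 : 0 <= e := enorm_ge0 _.
have D50 := D5_ge mu_gt0 muL Cf0 Lf0 rf0 rg0 nu0 (erefl S) (erefl S0).
apply: opnorm_le => [|v u]; first by rewrite mulr_ge0 // D5_ge0.
rewrite penalty_star_hess_sub.
have v0 := enorm_ge0 v; have u0 := enorm_ge0 u.
have zxx := graph_pen_lipschitz x' x; rewrite -/e in zxx.
have z0xx := graph0_lipschitz x' x; rewrite -/e in z0xx.
have Tv := tangent_pen_bounded x v; have Tu := tangent_pen_bounded x' u.
have T0v := tangent0_bounded x v.
have EL : 0 <= E / lam by rewrite divr_ge0 // ltW.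
have CL : 0 <= Cf / (lam * mu) by rewrite divr_ge0 // mulr_ge0 // ltW.
have t1 : dot (v *m Tl x *m (hess f (zl x) - hess f (zl x'))) (u *m Tl x')
    <= rhof * (S * e) * (S * enorm v) * (S * enorm u).
  apply: le_trans (ler_norm _) _; apply: le_trans (hess_lipschitz _ _ _ _ f_hess) _.
  by rewrite !ler_pM ?mulr_ge0 ?enorm_ge0.
have t2 : dot (v *m Tl x *m (hess g (zl x) - hess g (zl x')
                - (hess g (z0 x) - hess g (z0 x')))) (u *m Tl x')
    <= (nug * (S * e) * (Cf / (lam * mu)) + rhog * (E / lam * e))
       * (S * enorm v) * (S * enorm u).
  (* The second difference estimate asks for one bound on the increments of both graphs; [S0 <= S]
     provides it. *)
  have S0S : enorm (z0 x - z0 x') <= S * e by rewrite (le_trans z0xx) // ler_wpM2r.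
  apply: le_trans (ler_norm _) _.
  apply: le_trans (hess_second_difference _ _ rg0 nu0 g_hess g_third zxx S0S) _.
  have c0 : 0 <= nug * (S * e) * enorm (zl x - z0 x)
                 + rhog * enorm (zl x - zl x' - (z0 x - z0 x')).
    by rewrite addr_ge0 // mulr_ge0 ?enorm_ge0 ?mulr_ge0.
  apply: ler_pM Tu; rewrite ?mulr_ge0 ?enorm_ge0 //.
  apply: ler_pM Tv; rewrite ?enorm_ge0 //.
  apply: lerD; rewrite ler_wpM2l ?mulr_ge0 //; first exact: minimizer_gap.
  exact: minimizer_gap_lipschitz.
have Tgap y w : enorm (w *m Tl y - w *m T0 y) <= E / lam * enorm w.
  by rewrite !mul_tangent row_mx_sub enorm_row_mx0 inner_jacobian_gap.
have t3 : dot ((v *m Tl x - v *m T0 x) *m (hess g (z0 x) - hess g (z0 x'))) (u *m Tl x')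
    <= rhog * (S0 * e) * (E / lam * enorm v) * (S * enorm u).
  apply: le_trans (ler_norm _) _; apply: le_trans (hess_lipschitz _ _ _ _ g_hess) _.
  by rewrite !ler_pM ?mulr_ge0 ?enorm_ge0.
have t4 : dot (v *m T0 x *m (hess g (z0 x) - hess g (z0 x'))) (u *m Tl x' - u *m T0 x')
    <= rhog * (S0 * e) * (S0 * enorm v) * (E / lam * enorm u).
  apply: le_trans (ler_norm _) _; apply: le_trans (hess_lipschitz _ _ _ _ g_hess) _.
  by rewrite !ler_pM ?mulr_ge0 ?enorm_ge0.
(* After [lam] cancels, [t2] gives the [nug] term and [S ^+ 2], [t3] gives [S * S0], and [t4] gives
   [S0 ^+ 2]. *)
apply: le_trans (_ : _ <= (rhof * S ^+ 3 + nug * S ^+ 3 * (Cf / mu)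
    + rhog * E * (S ^+ 2 + S * S0 + S0 ^+ 2)) * e * enorm v * enorm u) _; last first.
  by rewrite !ler_wpM2r.
apply: le_trans (lerD t1 (ler_wpM2l (ltW lam_gt0) (lerD (lerD t2 t3) t4))) _.
rewrite le_eqVlt; apply/orP; left; apply/eqP.
by field; rewrite !gt_eqF.
Qed.

End Penalty.

(* For [lam = 0] the penalty need not have a minimizer; it is then affine, and
   [ystar_pen] is a constant (possibly the default value of [argmin]). *)
Lemma affine_penalty_star (R : realType) (dx dy : nat) (f g : 'rV[R]_(dx + dy) -> R)
    (D : R) : 0 <= D -> lipschitz_grad 0 f -> lipschitz_hess D (penalty_star f g 0).
Proof.
move=> D0 f0; set c := grad f 0.
(* With Lipschitz constant 0 the Taylor remainder vanishes. *)
have fE z : f z = f 0 + dot c z.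
  have := taylor1 0 z (lexx 0) f0; rewrite mul0r normr_le0 add0r.
  by rewrite subr_eq0 subr_eq addrC => /eqP.
have pE x y : penalty f g 0 x y = f 0 + dot (lsubmx c) x + dot (rsubmx c) y.
  by rewrite /penalty mul0r addr0 fE -[c in dot c]hsubmxK dot_row_mx addrA.
(* The sets of minimizers at [x] and at 0 coincide, even when empty, so [get] picks the same
   point. *)
have yE x : ystar_pen f g 0 x = ystar_pen f g 0 0.
  rewrite /ystar_pen /argmin; congr get; apply/seteqP.
  by split=> y /= hy y'; have := hy y'; rewrite !pE !lerD2l.
have sE x : penalty_star f g 0 x
    = f 0 + dot (lsubmx c) x + dot (rsubmx c) (ystar_pen f g 0 0).
  by rewrite /penalty_star pE yE.
have sgrad x : differentiable (penalty_star f g 0) x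
    /\ grad (penalty_star f g 0) x = lsubmx c.
  apply: (@grad_of_remainder _ _ _ _ _ 0) => k; rewrite !sE dotDr mul0r normr_le0.
  by apply/eqP; ring.
have shess x : differentiable (grad (penalty_star f g 0)) x
    /\ hess (penalty_star f g 0) x = 0.
  apply: (@jacobian_of_remainder _ _ _ _ _ _ 0) => k.
  by rewrite !(sgrad _).2 subrr mulmx0 subrr enorm0 mul0r.
split=> [|x x']; first by split=> x; [exact: (sgrad x).1|exact: (shess x).1].
rewrite !(shess _).2 subrr; apply: opnorm_le => [|p q].
  by rewrite mulr_ge0 ?enorm_ge0.
by rewrite mulmx0 dot0l !mulr_ge0 ?enorm_ge0.
Qed.

(** [C] is fixed before the dimensions and all constants, so it is absolute. For [dy = 0] strong
    convexity would be void and would not bound [mu] by [Lg]. *)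
Theorem lemmaC2 (R : realType) :
  exists C : R, 0 < C /\
  forall (dx dy : nat) (f g : 'rV[R]_(dx + dy) -> R)
         (mu Cf Lf Lg rhof rhog nug lam : R),
    (0 < dy)%N ->
    0 < mu ->
    (forall x : 'rV[R]_dx,
       strongly_convex mu (fun y : 'rV[R]_dy => g (row_mx x y))) ->
    lipschitz_grad Lg g ->
    lipschitz_hess rhog g ->
    lipschitz_third nug g ->
    lipschitz_in_y Cf f ->
    lipschitz_grad Lf f ->
    lipschitz_hess rhof f ->
    C3 f ->
    (exists m : R, forall x : 'rV[R]_dx, m <= hyperobj f g x) ->
    2 * Lf / mu <= lam ->
    lipschitz_hess (D5 mu Cf Lf Lg rhof rhog nug) (penalty_star f g lam) /\
    D5 mu Cf Lf Lg rhof rhog nug <=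
      C * ell Cf Lf Lg rhof rhog nug * kappa mu Cf Lf Lg rhof rhog nug ^+ 5.
Proof.
exists 375; split=> // dx dy f g mu Cf Lf Lg rhof rhog nug lam dy0 mu0 gmu gL gr gn
  fC fL fr _ _ lamL.
have Cf0 : 0 <= Cf := in_y_cst_ge0 dy0 fC.
have Lf0 : 0 <= Lf := lipschitz_grad_ge0 dy0 fL.
have rf0 : 0 <= rhof := lipschitz_hess_ge0 dy0 fr.
have rg0 : 0 <= rhog := lipschitz_hess_ge0 dy0 gr.
have nu0 : 0 <= nug by apply: lipschitz_third_ge0 gn; rewrite addn_gt0 dy0 orbT.
have muL : mu <= Lg := strong_convexity_le dy0 mu0 gmu gL gr.
split; last exact: D5_le.
have : 0 <= lam by apply: le_trans lamL; rewrite divr_ge0 ?mulr_ge0 // ltW.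
(* The bounds in [1 / lam] require [lam > 0]. The case [lam = 0] forces [Lf = 0], which makes [f]
   affine. *)
rewrite le_eqVlt => /predU1P[lam_eq0|lam_gt0]; last first.
  exact: penalty_star_hess_lipschitz.
have Lf_eq0 : Lf = 0.
  apply/eqP; rewrite eq_le Lf0 andbT; move: lamL.
  by rewrite -lam_eq0 ler_pdivrMr // mul0r pmulr_rle0.
rewrite -lam_eq0; apply: affine_penalty_star; last by rewrite -Lf_eq0.
exact: D5_ge0.
Qed.
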